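(* Let $k\geq 2$ be an even integer and let $\Delta\colon\mathbb{N}\to\mathbb{N}$ be an arbitrary coloring. Then there is an infinite set $X=\{x_1<x_2<\cdots\}\subseteq\mathbb{N}$ such that the set $X^*_{alt}=X^*_{alt}(k)=\{\sum^*_{j\in J}x_j : J\in\binom{\mathbb{N}}{k}\}$ is colored according to one of the following patterns: (i) $X^*_{alt}$ is monochromatic; or (ii) $X^*_{alt}$ is rainbow; or (iii) $\Delta(\sum^*_{i\in I}x_i)=\Delta(\sum^*_{j\in J}x_j)$ if and only if $\max I=\max J$, for all $I,J\in\binom{\mathbb{N}}{k}$; or (iv) $\Delta(\sum^*_{i\in I}x_i)=\Delta(\sum^*_{j\in J}x_j)$ if and only if $\min I=\min J$, for all $I,J\in\binom{\mathbb{N}}{k}$; or (v) $\Delta(\sum^*_{i\in I}x_i)=\Delta(\sum^*_{j\in J}x_j)$ if and only if $\min I=\min J$ and $\max I=\max J$, for all $I,J\in\binom{\mathbb{N}}{k}$. For $k\geq 4$ none of the five patterns may be omitted without violating the theorem (i.e., for each pattern there is a coloring $\Delta\colon\mathbb{N}\to\mathbb{N}$ such that no infinite $X\subseteq\mathbb{N}$ satisfies any of the other four patterns). For $k=2$ patterns (ii) and (v) coincide, and none of the four patterns (i)–(iv) may be omitted without violating the theorem.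
   Context: $\mathbb{N}$ denotes the set of positive integers; $\binom{\mathbb{N}}{k}$ is the set of $k$-element subsets of $\mathbb{N}$. The elements of $X$ are indexed increasingly $x_1<x_2<\cdots$, and for even $k$ and $J=\{j_1<j_2<\cdots<j_k\}$, $\sum^*_{j\in J}x_j=x_{j_k}-x_{j_{k-1}}+x_{j_{k-2}}-x_{j_{k-3}}+\cdots+x_{j_2}-x_{j_1}$. Monochromatic: all elements receive the same color; rainbow: all elements receive pairwise distinct colors.
   Formalization: ''For k=2, (ii) and (v) coincide'' fails literally (X=ℕ, Δ=id: rainbow, but 2−1=3−2). Proved instead for k=2: (v) implies (ii); they are equivalent if distinct index sets give distinct alternating sums; and any X with (ii) has an infinite subset with (v). *)

(* Defs.v *)
From mathcomp Require Export all_boot finmap.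

Set Implicit Arguments.
Unset Strict Implicit.
Unset Printing Implicit Defensive.

(* Positive integers are represented inside nat: a coloring of the positive
   integers by positive integers is a total function whose value at 0 is
   irrelevant. *)
Definition coloring (Delta : nat -> nat) : Prop :=
  forall n, 0 < n -> 0 < Delta n.

(* An infinite set X = {x_1 < x_2 < ...} of positive integers is given by its
   increasing enumeration x 1, x 2, ...; the value x 0 is irrelevant. *)
Definition infinite_set_enum (x : nat -> nat) : Prop :=
  0 < x 1 /\ (forall i j, 0 < i -> i < j -> x i < x j).

Definition enum_subset (y x : nat -> nat) : Prop :=
  forall i, 0 < i -> exists2 j, 0 < j & y i = x j.

Definition ksubset (k : nat) (J : {fset nat}) : Prop :=
  #|` J| = k /\ (forall j, j \in J -> 0 < j).

(* [:: j_1; ...; j_k] with j_1 < ... < j_k; positions are counted from 0. *)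
Definition listing (J : {fset nat}) : seq nat := sort leq (enum_fset J).

Definition minJ (J : {fset nat}) : nat := head 0 (listing J).
Definition maxJ (J : {fset nat}) : nat := last 0 (listing J).

(* (x_{j_2} - x_{j_1}) + (x_{j_4} - x_{j_3}) + ... + (x_{j_k} - x_{j_{k-1}})
   for #|` J| = k even. Truncated subtraction is exact here, since x is
   increasing on positive indices. *)
Definition altsum (x : nat -> nat) (J : {fset nat}) : nat :=
  \sum_(i < #|` J|./2)
    (x (nth 0 (listing J) i.*2.+1) - x (nth 0 (listing J) i.*2)).

Definition Xalt (k : nat) (x : nat -> nat) (n : nat) : Prop :=
  exists2 J, ksubset k J & n = altsum x J.

Definition monochromatic (Delta : nat -> nat) (A : nat -> Prop) : Prop :=
  forall m n, A m -> A n -> Delta m = Delta n.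

Definition rainbow (Delta : nat -> nat) (A : nat -> Prop) : Prop :=
  forall m n, A m -> A n -> m <> n -> Delta m <> Delta n.

Inductive pattern : Type := P_i | P_ii | P_iii | P_iv | P_v.

Definition has_pattern (k : nat) (Delta x : nat -> nat) (p : pattern) : Prop :=
  match p with
  | P_i => monochromatic Delta (Xalt k x)
  | P_ii => rainbow Delta (Xalt k x)
  | P_iii => forall I J, ksubset k I -> ksubset k J ->
      (Delta (altsum x I) = Delta (altsum x J) <-> maxJ I = maxJ J)
  | P_iv => forall I J, ksubset k I -> ksubset k J ->
      (Delta (altsum x I) = Delta (altsum x J) <-> minJ I = minJ J)
  | P_v => forall I J, ksubset k I -> ksubset k J ->
      (Delta (altsum x I) = Delta (altsum x J) <->
       minJ I = minJ J /\ maxJ I = maxJ J)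
  end.

(* Rainbow is a condition on the set Xalt k x, whereas pattern (v) is a
   condition on index sets, so for k = 2 they can only be literally equivalent
   when distinct index sets have distinct alternating sums: with x i = i and
   Delta n = n, pattern (ii) holds but (v) fails as 2 - 1 = 3 - 2. *)
Definition distinct_altsums (k : nat) (x : nat -> nat) : Prop :=
  forall I J, ksubset k I -> ksubset k J -> altsum x I = altsum x J -> I = J.

(* Main.v *)
Require Import Defs.
From mathcomp Require Import all_boot finmap.
From mathcomp Require Import boolp classical_sets filter zify.

Set Implicit Arguments.
Unset Strict Implicit.
Unset Printing Implicit Defensive.

(* An idempotent ultrafilter [p] on the positive integers gives a notion of "most"
   that is stable under addition, so that every equation
   [Delta (a + ... ) = Delta (b + ...)] between sums of generic integers is decided
   and its truth value is insensitive to splitting a generic summand in two. As in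
   Taylor's canonical partition theorem, four such equations decide the pattern:
   [Delta a = Delta b] gives (i), [Delta (a + b) = Delta a] gives (iv),
   [Delta (a + b) = Delta b] gives (iii), [Delta (a + b + c) = Delta (a + c)] gives
   (v), and (ii) holds if all of them fail. A diagonal choice produces generic
   [y_0, y_1, ...], and [X] is the set of their partial sums, whose alternating
   sums are sums of [y] over [k / 2] blocks.

   For sharpness, the colorings are: constant; injective; the integer part of log2;
   the 2-adic valuation; and the pair of the last two. *)

(** * Idempotent ultrafilters *)

Section IdempotentUltrafilter.
Local Open Scope classical_set_scope.
Variables (T : Type) (op : T -> T -> T).
Hypothesis opA : associative op.

Definition shift (x : T) (A : set T) : set T := [set y | A (op x y)].

(** The last clause makes the ultrafilters extending [F] closed under the product. [F setT] is left
    out so that the empty system, the union of the empty chain in Zorn's lemma, qualifies. *)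
Definition preidempotent (F : set_system T) :=
  [/\ setI_closed F, forall A B, A `<=` B -> F A -> F B, ~ F set0
    & forall A, F A -> F [set x | F (shift x A)]].

Lemma preidempotent_maximal (t : T) : exists F, [/\ preidempotent F, F setT
  & forall G, preidempotent G -> F `<=` G -> G `<=` F].
Proof.
have [|F [PF Fmax]] := @Zorn_bigcup _ preidempotent.
  move=> C CP Ctot; split.
  - move=> A B [F CF FA] [G CG GB].
    have [FG|GF] := Ctot _ _ CF CG.
      by exists G => //; have [+ _ _ _] := CP _ CG; apply => //; exact: FG.
    by exists F => //; have [+ _ _ _] := CP _ CF; apply => //; exact: GF.
  - move=> A B AB [F CF FA]; exists F => //.
    by have [_ + _ _] := CP _ CF; apply; last exact: FA.
  - by move=> [F CF F0]; have [_ _ + _] := CP _ CF; apply.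
  - move=> A [F CF FA]; have [_ sF _ iF] := CP _ CF.
    by exists F => //; apply: sF (iF _ FA) => x /= ?; exists F.
have {}Fmax G : preidempotent G -> F `<=` G -> G `<=` F.
  move=> PG FG A GA; apply: contrapT => nFA.
  by apply: (Fmax G) PG; split => // /(_ _ GA).
exists F; split=> //.
have [IF SF F0 iF] := PF.
have [[A FA]|nF] := EM (exists A, F A); first exact: SF FA.
(* If the maximal system were empty, [[set setT]] would extend it; the point [t] keeps [setT] apart
   from [set0]. *)
apply: (Fmax [set setT]) => //; last by move=> A FA; case: nF; exists A.
split.
- by move=> A B /= -> ->; rewrite setIT.
- by move=> A B AB /= eA; rewrite eA in AB; apply/seteqP; split.
- by move=> /= e0; have : [set: T] t by []; rewrite -e0.
- by move=> A /= ->; apply/seteqP; split => // x _ /=; apply/seteqP; split.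
Qed.

(* Ellis' argument: [F] plays the role of a minimal closed subsemigroup [C] of
   the Stone-Cech compactification; the two filters below are those of
   [C p] and of [{q in C | q p = p}]. *)
Lemma idempotent_ultrafilter (t : T) : exists p : set_system T,
  UltraFilter p /\ forall A, p A -> p [set x | p (shift x A)].
Proof.
have [F [PF FT Fmax]] := preidempotent_maximal t.
have [IF SF F0 iF] := PF.
have FF : ProperFilter F by split => //; split.
have [p [pU Fp]] := ultraFilterLemma FF.
exists p; split=> //.
have p_proper := @ultra_proper _ p pU.
pose near_p A : set T := [set x | p (shift x A)].
have near_pS A B : A `<=` B -> near_p A `<=` near_p B.
  by move=> AB x /=; apply: filterS => y; exact: AB.
have near_shift x A : shift x (near_p A) = near_p (shift x A).
  by apply: funext => y; rewrite /shift /near_p /shift /=; under eq_fun do rewrite -opA.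
have Fnear : [set A | F (near_p A)] `<=` F.
  apply: Fmax; last first.
    move=> A FA /=; apply: SF (iF _ FA) => x /=; exact: Fp.
  split.
  - move=> A B FA FB /=; apply: SF (IF _ _ FA FB) => x /= [] pA pB.
    exact: filterI pA pB.
  - by move=> A B AB /=; apply: SF; exact: near_pS.
  - by move=> /=; apply: contra_not F0; apply: SF => x /= /filter_not_empty.
  - move=> A /= FA; have := iF _ (iF _ FA); apply: (SF) => x /= Fx.
    by apply: Fp; apply: SF Fx => y /=; rewrite /shift /= -near_shift.
pose H : set_system T := [set B | exists F0 A, [/\ F F0, p A & F0 `&` near_p A `<=` B]].
have FH : H `<=` F.
  apply: Fmax; last first.
    by move=> A FA; exists A, setT; split=> //; exact: filterT.
  split.
  - move=> B B' [G [A [FG pA sB]]] [G' [A' [FG' pA' sB']]].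
    exists (G `&` G'), (A `&` A'); split.
    + exact: IF.
    + exact: filterI.
    + move=> x [[Gx G'x] pAx]; split; [apply: sB | apply: sB']; split=> //;
      by apply: near_pS pAx => z [].
  - move=> B B' BB' [G [A [FG pA sB]]]; exists G, A; split=> //.
    exact: subset_trans BB'.
  (* Properness: if [G] missed [near_p A], it would lie in [near_p] of the complement of [A]; by
     [Fnear] this complement would be in [F], hence in [p]. *)
  - move=> [G [A [FG pA sB]]].
    have : F (~` A).
      apply: Fnear => /=; apply: SF FG => x Gx /=.
      have [pxA|//] := in_ultra_setVsetC (shift x A) pU.
      by have := sB x (conj Gx pxA).
    move/Fp => pnA; apply: (@filter_not_empty _ p).
    by apply: filterS (filterI pA pnA) => x [].
  - move=> B [G [A [FG pA sB]]].
    exists [set x | F (shift x G)], A; split=> //; first exact: iF.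
    move=> x [/= FxG pxA]; exists (shift x G), (shift x A); split=> //.
    by rewrite -near_shift => y [] ? ?; exact: sB.
move=> A pA; apply: Fp; apply: FH; exists setT, A; split=> //.
Qed.

End IdempotentUltrafilter.

(** The bound [0 < n] in the second clause makes [p] concentrate on positive integers. The converse
    of the last clause follows by applying it to the complement of [A]. *)
Definition idempotent_nat (p : (nat -> Prop) -> Prop) :=
  [/\ forall A B, p A -> p B -> p (fun n => A n /\ B n),
      forall A B : nat -> Prop, (forall n, 0 < n -> A n -> B n) -> p A -> p B,
      ~ p (fun=> False),
      forall A, p A \/ p (fun n => ~ A n)
    & forall A, p A -> p (fun x => p (fun y => A (x + y)))].

Lemma idempotent_nat_exists : exists p, idempotent_nat p.
Proof.
(* [x, y |-> (x + y).+1] is addition of positive integers read through [succn] *)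
have opA : associative (fun x y => (x + y).+1).
  by move=> x y z; rewrite addnS addSn addnA.
have [q [qU qD]] := idempotent_ultrafilter opA 0.
have q_proper := @ultra_proper _ q qU.
exists (fun A => q (fun n => A n.+1)); split.
- by move=> A B; exact: filterI.
- by move=> A B AB; apply: filterS => n; exact: AB.
- exact: filter_not_empty.
- by move=> A; exact: in_ultra_setVsetC.
- move=> A /qD; apply: filterS => x /=; apply: filterS => y.
  by rewrite /shift /= addSn addnS.
Qed.

(** * Generic sums *)

Definition letter : Type := bool * bool.
Definition msum (b : seq bool) (h : seq nat) : nat := sumn (mask b h).
(** The count starts from the silent letter, since silence in front of a word has no effect on the
    sums. *)
Definition changes (l : seq letter) : nat :=
  sumn (pairmap (fun c d => (c != d : nat)) (false, false) l).

Lemma msum_rcons b c h y : size b = size h ->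
  msum (rcons b c) (rcons h y) = msum b h + c * y.
Proof.
move=> bh; rewrite /msum -!cats1 mask_cat // sumn_cat.
by case: c; rewrite /= ?mul1n ?mul0n ?addn0.
Qed.

Lemma changes_rcons l c : changes (rcons l c) = changes l + (last (false, false) l != c).
Proof. by rewrite /changes -cats1 pairmap_cat sumn_cat /= addn0. Qed.

(* [p A] reads "A holds for most positive integers". *)
Section Generic.
Variables (p : (nat -> Prop) -> Prop).
Hypothesis p_idem : idempotent_nat p.
Implicit Types (R : nat -> nat -> Prop) (w l : seq letter) (c : letter).

Lemma most_and A B : p A -> p B -> p (fun n => A n /\ B n).
Proof. by case: p_idem => + _ _ _ _; apply. Qed.

Lemma most_mono (A B : nat -> Prop) : (forall n, 0 < n -> A n -> B n) -> p A -> p B.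
Proof. by case: p_idem => _ + _ _ _; apply. Qed.

Lemma most_em A : p A \/ p (fun n => ~ A n).
Proof. by case: p_idem => _ _ _ + _; apply. Qed.

Lemma most_ex A : p A -> exists2 y, 0 < y & A y.
Proof.
case: p_idem => _ pS p0 _ _ pA; apply: contrapT => nA; apply: p0.
by apply: pS pA => n n_gt0 An; apply: nA; exists n.
Qed.

Lemma most_true (A : nat -> Prop) : (forall n, 0 < n -> A n) -> p A.
Proof.
move=> AT; have [//|/most_ex[y /AT + nA]] := most_em A.
by move/nA.
Qed.

Lemma most_cst (Q : Prop) : p (fun=> Q) <-> Q.
Proof. by split=> [/most_ex[]|q]; last exact: most_true. Qed.

Lemma most_add A : p A -> p (fun x => p (fun y => A (x + y))).
Proof. by case: p_idem => _ _ _ _; apply. Qed.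

Lemma most_all (I : eqType) (s : seq I) (Q : I -> nat -> Prop) :
  (forall i, i \in s -> p (Q i)) -> p (fun y => forall i, i \in s -> Q i y).
Proof.
elim: s => [_|i s IHs pQ]; first exact: most_true.
have pi := pQ i (mem_head _ _).
have {}IHs : p (fun y => forall j, j \in s -> Q j y).
  by apply: IHs => j js; apply: pQ; rewrite inE js orbT.
apply: most_mono (most_and pi IHs) => y _ [Qi Qs] j.
by rewrite inE => /predU1P[->|/Qs].
Qed.

(* A letter tells which of the two sums [u], [v] receives the next generic summand. *)
Fixpoint gen w R u v : Prop :=
  if w is c :: w' then p (fun y => gen w' R (u + c.1 * y) (v + c.2 * y))
  else R u v.

Lemma gen_mono w R R' u v :
  (forall u v, R u v -> R' u v) -> gen w R u v -> gen w R' u v.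
Proof.
move=> RR'; elim: w u v => [|c w IHw] u v /=; first exact: RR'.
by apply: most_mono => y _; exact: IHw.
Qed.

Lemma gen_and w R R' u v :
  gen w R u v -> gen w R' u v -> gen w (fun u v => R u v /\ R' u v) u v.
Proof.
elim: w u v => [//|c w IHw] u v /= g g'.
by apply: most_mono (most_and g g') => y _ []; exact: IHw.
Qed.

Lemma gen_em w R u v : gen w R u v \/ gen w (fun u v => ~ R u v) u v.
Proof.
elim: w u v => [|c w IHw] u v /=; first exact: EM.
have [|ng] := most_em (fun y => gen w R (u + c.1 * y) (v + c.2 * y)); first by left.
by right; apply: most_mono ng => y _ nR; case: (IHw (u + c.1 * y) (v + c.2 * y)).
Qed.

Lemma gen_cst w (Q : Prop) u v : gen w (fun _ _ => Q) u v <-> Q.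
Proof.
elim: w u v => [//|c w IHw] u v /=; rewrite -[X in _ <-> X]most_cst.
by split; apply: most_mono => y _ /IHw.
Qed.

Lemma gen_clash w R u v : gen w R u v -> gen w (fun u v => ~ R u v) u v -> False.
Proof.
move=> g ng; apply/(gen_cst w _ u v).
by apply: gen_mono (gen_and g ng) => ? ? [].
Qed.

Lemma gen_cat w w' R u v : gen (w ++ w') R u v = gen w (gen w' R) u v.
Proof. by elim: w u v => [//|c w IHw] u v /=; under eq_fun do rewrite IHw. Qed.

Lemma gen_iff_cst w R (Q : Prop) u v :
  gen w (fun u v => R u v <-> Q) u v <-> (gen w R u v <-> Q).
Proof.
have [q|nq] := EM Q.
  split=> [g|g].
    by split=> // _; apply: gen_mono g => ? ? [_]; apply.
  by apply: gen_mono (g.2 q) => ? ?; split.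
split=> [g|g].
  split=> // gR; case: (gen_clash gR).
  by apply: gen_mono g => ? ? [RQ _] /RQ.
have [/g//|] := gen_em w R u v.
by apply: gen_mono => ? ? nR; split.
Qed.

(** Idempotency: a generic summand splits into two, of which the first can be fixed while the second
    stays generic. *)
Lemma gen_stay c w R u v : gen (c :: w) R u v ->
  p (fun y => gen (c :: w) R (u + c.1 * y) (v + c.2 * y)).
Proof.
move=> /most_add; apply: most_mono => x _ /=; apply: most_mono => y _.
by rewrite !mulnDr !addnA.
Qed.

(** One direction is [gen_stay], the other is [gen_stay] for the negated relation. Hence only the
    succession of blocks in a word matters. *)
Lemma gen_stutter c w R u v : gen [:: c, c & w] R u v <-> gen (c :: w) R u v.
Proof.
split=> [gcc|/gen_stay//].
have [//|/gen_stay ng] := gen_em (c :: w) R u v.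
by case: (@gen_clash [:: c, c & w] R u v).
Qed.

Lemma gen_skip w R u v : gen ((false, false) :: w) R u v <-> gen w R u v.
Proof.
rewrite -[X in _ <-> X]most_cst.
by split; apply: most_mono => y _; rewrite !mul0n !addn0.
Qed.

Lemma gen_last l w R u v :
  gen (l ++ last (false, false) l :: w) R u v <-> gen (l ++ w) R u v.
Proof.
case/lastP: l => [|l c]; first exact: gen_skip.
rewrite last_rcons !cat_rcons !gen_cat.
by split; apply: gen_mono => ? ?; rewrite gen_stutter.
Qed.

(* The summands [h] chosen so far are generic for every word [l] that they may
   spell; the second conjunct lets the last letter of [l] absorb one more summand. *)
Definition decided_along M R h := forall l w, size l = size h ->
  changes l + size w <= M ->
  let u := msum (unzip1 l) h in let v := msum (unzip2 l) h in
  let S := fun u v => R u v <-> gen (l ++ w) R 0 0 in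
  gen w S u v /\ gen (last (false, false) l :: w) S u v.

Lemma decided_nil M R : decided_along M R [::].
Proof.
move=> l w /size0nil -> _ /=.
have g : gen w (fun u v => R u v <-> gen w R 0 0) 0 0 by apply/gen_iff_cst.
by split=> //; exact/(gen_skip w).
Qed.

(** For fixed [h] finitely many pairs of a past [l] and a future [w] have to be served, and each is
    served by most [y]. *)
Lemma decided_rcons M R h : decided_along M R h ->
  exists2 y, 0 < y & decided_along M R (rcons h y).
Proof.
move=> dh.
pose step (lw : seq letter * seq letter) y :=
  let u := msum (unzip1 lw.1) (rcons h y) in
  let v := msum (unzip2 lw.1) (rcons h y) in
  let S := fun u v => R u v <-> gen (lw.1 ++ lw.2) R 0 0 in
  changes lw.1 + size lw.2 <= M ->
  gen lw.2 S u v /\ gen (last (false, false) lw.1 :: lw.2) S u v.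
suff /most_ex[y y_gt0 st] : p (fun y =>
    forall i, i \in enum {: (size h).+1.-tuple letter * M.-bseq letter} ->
      step (val i.1, val i.2) y).
  exists y => // l w; rewrite size_rcons => lh lw.
  have wM : size w <= M by apply: leq_trans lw; rewrite leq_addl.
  by apply: (st (Tuple (introT eqP lh), Bseq wM)); rewrite ?mem_enum.
apply: most_all => -[[l /= /eqP lh] [w /= wM]] _.
case/lastP: l lh => // l c; rewrite size_rcons => -[lh].
rewrite /step /=; have [lw|] := leqP; last by move=> _; exact: most_true.
have g : gen (c :: w) (fun u v => R u v <-> gen (rcons l c ++ w) R 0 0)
             (msum (unzip1 l) h) (msum (unzip2 l) h).
  move: lw; rewrite changes_rcons cat_rcons.
  (* A repeated letter is covered by the second conjunct of [decided_along]; a new letter costs one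
     change, paid for by one letter of the future. *)
  have [<-|_] := eqVneq => /= lw.
    rewrite addn0 in lw; have [_] := dh l w lh lw.
    by apply: gen_mono => ? ?; rewrite gen_last.
  by have [|//] := dh l (c :: w) lh; rewrite /= addnS -addSn -addn1.
have g' := gen_stay g.
apply: most_mono (most_and g g') => y _ [gw gcw] _.
by rewrite /unzip1 /unzip2 !map_rcons last_rcons !msum_rcons ?size_map.
Qed.

(** The bound concerns changes and not lengths: up to stuttering, a word with few changes has only
    finitely many possible futures, and each choice of a summand respects them all. *)
Theorem fusion M R : exists2 y : nat -> nat, forall i, 0 < y i &
  forall l, changes l <= M ->
    (R (msum (unzip1 l) (mkseq y (size l))) (msum (unzip2 l) (mkseq y (size l)))
     <-> gen l R 0 0).
Proof.
have stepP h : exists y, 0 < y /\ (decided_along M R h -> decided_along M R (rcons h y)).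
  have [/decided_rcons[y]|] := EM (decided_along M R h); first by exists y.
  (* A default value for undecided histories, which the construction never meets. *)
  by exists 1.
have [g gP] := choice stepP.
pose hist := fix hist n := if n is n'.+1 then rcons (hist n') (g (hist n')) else [::].
pose y n := g (hist n).
have histE n : hist n = mkseq y n by elim: n => //= n IHn; rewrite mkseqS -IHn.
have dec n : decided_along M R (mkseq y n).
  rewrite -histE; elim: n => [|n IHn] /=; first exact: decided_nil.
  by have [_] := gP (hist n); apply.
exists y => [i|l lM]; first by have [] := gP (hist i).
have [||] := dec (size l) l [::]; rewrite ?size_mkseq ?addn0 //.
by rewrite cats0.
Qed.

End Generic.

(** * Classification of the generic equations *)

Section Classification.
Variables (p : (nat -> Prop) -> Prop).
Hypothesis p_idem : idempotent_nat p.
Variable f : nat -> nat.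
Implicit Types (R : nat -> nat -> Prop) (w l : seq letter) (c : letter).

Local Notation gen := (gen p).
Local Notation most_mono := (most_mono p_idem).
Local Notation most_and := (most_and p_idem).
Local Notation gen_mono := (gen_mono p_idem).
Local Notation gen_and := (gen_and p_idem).
Local Notation gen_clash := (gen_clash p_idem).
Local Notation none := (false, false).
Local Notation fstonly := (true, false).
Local Notation both := (true, true).

Local Notation same := (fun u v => f u = f v).
Local Notation diff := (fun u v => f u <> f v).

Lemma gen_skipsl w' w R u v : all (pred1 none) w' ->
  gen (w' ++ w) R u v <-> gen w R u v.
Proof.
elim: w' => [//|c w' IHw] /= /andP[/eqP -> /IHw <-].
exact: (gen_skip p_idem (w' ++ w)).
Qed.

Lemma most_shift (E : nat -> Prop) u (b : bool) : E u -> p (fun y => E (u + y)) ->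
  p (fun y => E (u + b * y) /\ p (fun z => E (u + b * y + z))).
Proof.
move=> Eu Eu'; case: b; last first.
  by apply: (most_true p_idem) => y _; rewrite mul0n addn0.
apply: most_mono (most_and Eu' (most_add p_idem Eu')) => y _.
rewrite mul1n => -[? Eyz]; split=> //.
by apply: most_mono Eyz => z _; rewrite addnA.
Qed.

(** By idempotency both hypotheses survive each new summand. *)
Lemma gen_stable1 (E : nat -> Prop) w u v : E u -> p (fun y => E (u + y)) ->
  gen w (fun u _ => E u) u v.
Proof.
elim: w u v => [//|c w IHw] u v Eu Eu' /=.
by apply: most_mono (most_shift c.1 Eu Eu') => y _ [? ?]; exact: IHw.
Qed.

Lemma gen_stable2 (E : nat -> Prop) w u v : E v -> p (fun y => E (v + y)) ->
  gen w (fun _ v => E v) u v.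
Proof.
elim: w u v => [//|c w IHw] u v Ev Ev' /=.
by apply: most_mono (most_shift c.2 Ev Ev') => y _ [? ?]; exact: IHw.
Qed.

(** A nonempty sum of generic integers behaves like a single one. *)
Lemma gen_sum1 (E : nat -> Prop) w v : p E -> has fst w ->
  gen w (fun u _ => E u) 0 v.
Proof.
move=> pE; elim: w v => [//|[[] b] w IHw] v /= hw.
  apply: most_mono (most_and pE (most_add p_idem pE)) => y _ [Ey Ey'].
  by rewrite mul1n add0n; exact: gen_stable1.
by apply: (most_true p_idem) => y _; rewrite mul0n; exact: IHw.
Qed.

Lemma gen_sum2 (E : nat -> Prop) w u : p E -> has snd w ->
  gen w (fun _ v => E v) u 0.
Proof.
move=> pE; elim: w u => [//|[b []] w IHw] u /= hw.
  apply: most_mono (most_and pE (most_add p_idem pE)) => y _ [Ey Ey'].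
  by rewrite mul1n add0n; exact: gen_stable2.
by apply: (most_true p_idem) => y _; rewrite mul0n; exact: IHw.
Qed.

(** Both sums share their color with one further generic integer. *)
Lemma gen_const w : p (fun a => p (fun b => f a = f b)) -> has fst w -> has snd w ->
  gen w same 0 0.
Proof.
move=> E1 w1 w2.
apply: gen_mono (gen_and (gen_sum1 0 E1 w1) (gen_sum2 0 E1 w2)) => u v [pu pv].
by have [b _ [-> ->]] := most_ex p_idem (most_and pu pv).
Qed.

Lemma gen_min_same w : p (fun a => p (fun b => f (a + b) = f a)) ->
  gen (both :: w) same 0 0.
Proof.
move=> Dmin /=; apply: most_mono Dmin => y _ Dy; rewrite mul1n add0n.
have E1 : gen w (fun u _ => f u = f y) y y by apply: gen_stable1.
have E2 : gen w (fun _ v => f v = f y) y y by apply: gen_stable2.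
by apply: gen_mono (gen_and E1 E2) => u v [-> ->].
Qed.

(** The color of the first sum is frozen at that of its first summand [y]; the second sum consists
    of later generic integers, whose color is not [f y]. *)
Lemma gen_min_diff w : p (fun a => p (fun b => f (a + b) = f a)) ->
  p (fun a => p (fun b => f a <> f b)) -> has snd w ->
  gen (fstonly :: w) diff 0 0.
Proof.
move=> Dmin nE1 w2 /=; apply: most_mono (most_and Dmin nE1) => y _ [Dy Ey].
rewrite mul1n mul0n !addn0 add0n.
have E1 : gen w (fun u _ => f u = f y) y 0 by apply: gen_stable1.
have E2 := gen_sum2 y Ey w2.
by apply: gen_mono (gen_and E1 E2) => u v [->].
Qed.

(** Any sum reached before the last letter, even [0], leaves the color of a subsequent generic
    summand unchanged. *)
Lemma gen_max_same w : p (fun a => p (fun b => f (a + b) = f b)) ->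
  gen (rcons w both) same 0 0.
Proof.
move=> Dmax; rewrite -cats1 gen_cat /=.
pose E a := p (fun b => f (a + b) = f b).
have E0 : E 0 by apply: (most_true p_idem).
have E1 : gen w (fun u _ => E u) 0 0 by apply: gen_stable1.
have E2 : gen w (fun _ v => E v) 0 0 by apply: gen_stable2.
apply: gen_mono (gen_and E1 E2) => u v [Eu Ev].
by apply: most_mono (most_and Eu Ev) => y _; rewrite mul1n => -[-> ->].
Qed.

Lemma gen_max_diff w : p (fun a => p (fun b => f (a + b) = f b)) ->
  p (fun a => p (fun b => f a <> f b)) -> has snd w ->
  gen (rcons w fstonly) diff 0 0.
Proof.
move=> Dmax nE1 w2; rewrite -cats1 gen_cat /=.
pose E a := p (fun b => f (a + b) = f b).
have E1 : gen w (fun u _ => E u) 0 0.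
  by apply: gen_stable1 => //; apply: (most_true p_idem).
have E2 := gen_sum2 0 nE1 w2.
apply: gen_mono (gen_and E1 E2) => u v [Eu Ev].
apply: most_mono (most_and Eu Ev) => y _; rewrite mul1n mul0n addn0 => -[->].
exact: nesym.
Qed.

Lemma gen_not w R : (gen w R 0 0 -> False) -> gen w (fun u v => ~ R u v) 0 0.
Proof. by have [?|//] := gen_em p_idem w R 0 0. Qed.

(* If the last letter only feeds the first sum [u], then agreement with a fixed
   value makes [f] insensitive to lengthening [u] at the end. *)
Lemma gen_max_diff_nomin w : p (fun a => p (fun b => f (a + b) <> f a)) ->
  gen (rcons w fstonly) diff 0 0.
Proof.
move=> nDmin; apply: gen_not => g.
have E1 : gen (rcons w fstonly) (fun u _ => p (fun b => f (u + b) <> f u)) 0 0.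
  by apply: gen_sum1 => //; rewrite has_rcons.
apply: gen_clash E1 _; move: g; rewrite -cats1 !gen_cat.
apply: gen_mono => u v /= g; move: (most_and g (most_add p_idem g)).
apply: most_mono => y _ [fy fy'] nfy.
have [z _ []] := most_ex p_idem (most_and fy' nfy).
by move: fy; rewrite !mul1n !mul0n !addn0 addnA => -> ->.
Qed.

(** In front of a generic last summand, either sum can be replaced by the common first summand
    [y]. *)
Lemma gen_minmax_same w : p (fun a => p (fun b => p (fun d => f (a + b + d) = f (a + d)))) ->
  gen (both :: rcons w both) same 0 0.
Proof.
move=> Dmid /=; apply: most_mono Dmid => y _ Dy; rewrite mul1n add0n.
rewrite -cats1 gen_cat /=.
pose E x := p (fun z => f (x + z) = f (y + z)).
have Ey : E y by apply: (most_true p_idem).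
have E1 : gen w (fun u _ => E u) y y by apply: gen_stable1.
have E2 : gen w (fun _ v => E v) y y by apply: gen_stable2.
apply: gen_mono (gen_and E1 E2) => u v [Eu Ev].
by apply: most_mono (most_and Eu Ev) => z _; rewrite mul1n => -[-> ->].
Qed.

Lemma most_em2 (Q : nat -> nat -> Prop) :
  p (fun a => p (fun b => Q a b)) \/ p (fun a => p (fun b => ~ Q a b)).
Proof.
have [|n] := most_em p_idem (fun a => p (fun b => Q a b)); first by left.
right; apply: most_mono n => a _.
by have [|//] := most_em p_idem (Q a).
Qed.

Lemma most_em3 (Q : nat -> nat -> nat -> Prop) :
  p (fun a => p (fun b => p (fun d => Q a b d))) \/
  p (fun a => p (fun b => p (fun d => ~ Q a b d))).
Proof.
have [|n] := most_em2 (fun a b => p (fun d => Q a b d)); first by left.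
right; apply: most_mono n => a _; apply: most_mono => b _.
by have [|//] := most_em p_idem (Q a b).
Qed.

Lemma gen_minmax_diff w :
  p (fun a => p (fun b => p (fun d => f (a + b + d) = f (a + d)))) ->
  p (fun a => p (fun b => f (a + b) <> f b)) ->
  gen (fstonly :: rcons w both) diff 0 0.
Proof.
move=> Dmid nDmax.
(* Case [K] is absurd: for generic [a], [b], [c] it would give
   [f (a + b + c) = f (a + c) = f (b + c)], against [nDmax]. *)
have [K|nK] := most_em3 (fun a b z => f (a + z) = f (b + z)).
  have nDmax' : p (fun a => p (fun x => p (fun y => f (a + (x + y)) <> f (x + y)))).
    by apply: most_mono nDmax => a _ /(most_add p_idem).
  have [a _ [na [Ka Pa]]] := most_ex p_idem (most_and nDmax' (most_and K Dmid)).
  have [b _ [nb [Kb Pb]]] := most_ex p_idem (most_and na (most_and Ka Pa)).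
  have [c _ [nc [Kc Pc]]] := most_ex p_idem (most_and nb (most_and Kb Pb)).
  by case: nc; rewrite addnA Pc Kc.
move=> /=; apply: most_mono (most_and (most_and Dmid nDmax) nK) => y _ [[Dy ny] Ky].
rewrite mul1n mul0n !addn0 add0n -cats1 gen_cat /=.
pose E x := p (fun z => f (x + z) = f (y + z)).
have E1 : gen w (fun u _ => E u) y 0.
  by apply: gen_stable1 => //; apply: (most_true p_idem).
(* The second sum starts at [0], where the claim is [ny]; [Ky] handles its first summand. *)
have E2 : gen w (fun _ v => p (fun z => f (y + z) <> f (v + z))) y 0.
  by apply: gen_stable2.
apply: gen_mono (gen_and E1 E2) => u v [Eu Ev].
by apply: most_mono (most_and Eu Ev) => z _; rewrite mul1n => -[->].
Qed.

(** Silent letters drop out and the others merge by stuttering into one common summand. *)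
Lemma gen_diagonal w R u v : all (fun c => c.1 == c.2) w ->
  gen w R u v <-> (if has fst w then p (fun z => R (u + z) (v + z)) else R u v).
Proof.
elim: w u v => [//|[a b] w IHw] u v /= /andP[/eqP <- dw].
have {}IHw u' v' := IHw u' v' dw; case: a => /=; last first.
  by rewrite -IHw; exact: (gen_skip p_idem).
case: (has fst w) IHw => IHw; last first.
  by split; apply: most_mono => z _ /IHw; rewrite mul1n.
have st := gen_stutter p_idem both [::] R u v.
split=> g.
  have : gen [:: both] R u v by apply/st; apply: most_mono g => z _ /IHw;
    apply: most_mono => z' _; rewrite !mul1n.
  by apply: most_mono => z _; rewrite mul1n.
have /st : gen [:: both] R u v by apply: most_mono g => z _; rewrite mul1n.
apply: most_mono => z _ g'; apply/IHw.
by apply: most_mono g' => z' _; rewrite !mul1n.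
Qed.

(** The displayed letter is the last one on which the sums disagree. If the colors agreed,
    lengthening the first sum there would not affect its color, as the second sum does not move;
    this contradicts one of the two hypotheses, depending on whether a common summand follows. *)
Lemma gen_rainbow w w' :
  p (fun a => p (fun b => f (a + b) <> f a)) ->
  p (fun a => p (fun b => p (fun d => f (a + b + d) <> f (a + d)))) ->
  all (fun c => c.1 == c.2) w' ->
  gen (w ++ fstonly :: w') diff 0 0.
Proof.
move=> nDmin nDmid dw'; rewrite -cat_rcons gen_cat.
suff : gen (rcons w fstonly) (fun u v => if has fst w' then
         p (fun z => f (u + z) <> f (v + z)) else f u <> f v) 0 0.
  by apply: gen_mono => u v; rewrite gen_diagonal.
case: (has fst w'); last exact: gen_max_diff_nomin.
suff : gen (rcons w fstonly) (fun u v => ~ p (fun z => f (u + z) = f (v + z))) 0 0.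
  apply: gen_mono => u v n.
  by have [|] := most_em p_idem (fun z => f (u + z) = f (v + z)).
apply: gen_not => g.
have hw : has fst (rcons w fstonly) by rewrite has_rcons.
apply: gen_clash (gen_sum1 0 nDmid hw) _.
move: g; rewrite -cats1 !gen_cat.
apply: gen_mono => u v /= g; move: (most_and g (most_add p_idem g)).
apply: most_mono => y _ [fy fy'] nfy.
have [y' _ [gy ngy]] := most_ex p_idem (most_and fy' nfy).
have [z _ [fz [gz ngz]]] := most_ex p_idem (most_and fy (most_and gy ngy)).
move: fz gz ngz; rewrite !mul1n !mul0n !addn0 !addnA => -> ->.
exact.
Qed.

End Classification.

(** * Alternating sums as words *)

Definition alt (x : nat -> nat) (s : seq nat) : nat :=
  \sum_(i < (size s)./2) (x (nth 0 s i.*2.+1) - x (nth 0 s i.*2)).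

Definition klist (k : nat) (s : seq nat) : bool :=
  [&& sorted ltn s, size s == k & all (leq 1) s].

Lemma size_listing J : size (listing J) = #|` J|.
Proof. exact: size_sort. Qed.

Lemma mem_listing J : listing J =i J.
Proof. by move=> j; rewrite mem_sort. Qed.

Lemma altsumE x J : altsum x J = alt x (listing J).
Proof. by rewrite /alt size_listing. Qed.

Lemma sorted_listing J : sorted ltn (listing J).
Proof.
by rewrite ltn_sorted_uniq_leq sort_uniq fset_uniq sort_sorted //; exact: leq_total.
Qed.

Lemma klist_listing k J : ksubset k J -> klist k (listing J).
Proof.
move=> [cJ pJ]; rewrite /klist sorted_listing size_listing cJ eqxx /=.
by apply/allP => j; rewrite mem_listing => /pJ.
Qed.

Lemma listing_seq (s : seq nat) : sorted ltn s -> listing [fset j in s]%fset = s.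
Proof.
rewrite ltn_sorted_uniq_leq => /andP[us ss].
apply: (sorted_eq leq_trans anti_leq) => //; first exact: sort_sorted leq_total _.
rewrite perm_sort; apply: uniq_perm => //; first exact: fset_uniq.
by move=> j; rewrite in_fset.
Qed.

Lemma ksubset_seq k s : klist k s -> ksubset k [fset j in s]%fset.
Proof.
case/and3P=> ss /eqP sk /allP ps; split; first by rewrite -size_listing listing_seq.
by move=> j; rewrite in_fset => /ps.
Qed.

Lemma alt_cons2 x a b s : alt x [:: a, b & s] = (x b - x a) + alt x s.
Proof. by rewrite /alt /= big_ord_recl. Qed.

Lemma seq_pair_ind (P : seq nat -> Prop) : P [::] ->
  (forall a b s, P s -> P [:: a, b & s]) -> forall s, ~~ odd (size s) -> P s.
Proof.
move=> P0 P2 s; have [m] := ubnP (size s); elim: m s => // m IHm [|a [|b s]] //= sm.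
rewrite negbK => os; apply: P2; apply: IHm => //; exact: ltnW sm.
Qed.

(* For [x] the partial sums of [y], the alternating sum over the listing [s]
   collects the [y t] with [inside s t]: the blocks from [s_1] to [s_2 - 1], from
   [s_3] to [s_4 - 1], and so on. *)
Definition cnt (s : seq nat) n := count (fun j => j < n) s.
Definition inside (s : seq nat) t := odd (cnt s t.+1).

Lemma cnt_eq0 s n : all (leq n) s -> cnt s n = 0.
Proof.
move=> /allP sn; apply/eqP; rewrite -leqn0 leqNgt -has_count.
by apply/hasPn => j /sn; rewrite -leqNgt.
Qed.

Lemma cnt_size s n : all (fun j => j < n) s -> cnt s n = size s.
Proof. by move=> sn; apply/eqP; rewrite -all_count. Qed.

Lemma cntS s n : uniq s -> cnt s n.+1 = cnt s n + (n \in s).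
Proof.
move=> us; rewrite -count_uniq_mem // -count_predUI.
rewrite (@eq_count _ (predI _ _) pred0) ?count_pred0 ?addn0.
  by apply: eq_count => j /=; rewrite ltnS leq_eqVlt orbC.
by move=> j /=; case: eqVneq => [->|]; rewrite ?ltnn ?andbF.
Qed.

Lemma msum_mkseq b y n :
  msum (mkseq b n) (mkseq y n) = \sum_(t < n) b t * y t.
Proof.
elim: n => [|n IHn]; first by rewrite big_ord0.
by rewrite !mkseqS msum_rcons ?size_mkseq // IHn big_ord_recr.
Qed.

Definition partial_sum (y : nat -> nat) n := \sum_(t < n) y t.

Lemma partial_sum_mask y j n : j <= n ->
  partial_sum y j = \sum_(t < n) (t < j) * y t.
Proof.
move=> jn; rewrite /partial_sum (big_ord_widen n y jn) big_mkcond /=.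
by apply: eq_bigr => i _; case: ifP; rewrite ?mul1n ?mul0n.
Qed.

Lemma alt_msum y s n : sorted ltn s -> ~~ odd (size s) -> all (fun j => j <= n) s ->
  alt (partial_sum y) s = msum (mkseq (inside s) n) (mkseq y n).
Proof.
rewrite msum_mkseq => + os; elim/seq_pair_ind: s / os => [_ _|a b s IHs].
  by rewrite /alt big_ord0 big1.
rewrite alt_cons2 => ss /and3P[an bn sn].
have ab : a < b by case/andP: ss.
have /andP[_ bs] : sorted ltn [:: a, b & s] := ss.
have {}bs : all (ltn b) s by apply: order_path_min bs; exact: ltn_trans.
have {}IHs := IHs (subseq_sorted ltn_trans (suffix_subseq [:: a; b] s) ss) sn.
rewrite IHs !(@partial_sum_mask y _ n) //.
(* Adding the partial sum up to [a] on both sides removes the truncated subtraction. *)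
apply/eqP; rewrite -(eqn_add2r (\sum_(t < n) (t < a) * y t)).
rewrite -addnA [X in _ + X]addnC addnA subnK; last first.
  apply: leq_sum => i _; rewrite leq_mul2r; apply/orP; right.
  by case: (ltnP i a) => // /leq_trans/(_ (ltnW ab)) ->.
rewrite -!big_split; apply/eqP/eq_bigr => i _ /=; rewrite -!mulnDl; congr (_ * _).
rewrite /inside /cnt /= !ltnS -/(cnt s i.+1) -/(inside s i).
have [bi|ib] := leqP b i; last first.
  rewrite /inside cnt_eq0 ?addn0; last first.
    by apply/allP => j /(allP bs)/= /(ltn_trans ib).
  by case: ltnP.
by rewrite (leq_trans (ltnW ab) bi) ltnNge (leq_trans (ltnW ab) bi) /= negbK addn0.
Qed.

Section Klist.
Variables (k : nat) (s : seq nat).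
Hypotheses (k_ge2 : 2 <= k) (k_even : ~~ odd k) (sk : klist k s).

Let s_sorted : sorted ltn s. Proof. by case/and3P: sk. Qed.
Let s_size : size s = k. Proof. by case/and3P: sk => _ /eqP. Qed.
Let s_uniq : uniq s. Proof. by move: s_sorted; rewrite ltn_sorted_uniq_leq => /andP[]. Qed.
Let s_cons : s = head 0 s :: behead s.
Proof. by case: s s_size k_ge2 => //= <-. Qed.

Lemma klist_head_le j : j \in s -> head 0 s <= j.
Proof.
move: s_sorted; rewrite s_cons /= => /(order_path_min ltn_trans)/allP sj.
by rewrite inE => /predU1P[->//|/sj/ltnW].
Qed.

Lemma klist_le_last j : j \in s -> j <= last 0 s.
Proof.
move: s_sorted; rewrite (sorted_pairwise ltn_trans).
case/lastP: (s) => // s' m; rewrite last_rcons pairwise_rcons => /andP[/allP sm _].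
by rewrite mem_rcons inE => /predU1P[->//|/sm/ltnW].
Qed.

Lemma klist_mem_head : head 0 s \in s.
Proof. by rewrite [X in _ \in X]s_cons mem_head. Qed.

Lemma klist_mem_last : last 0 s \in s.
Proof. by rewrite {1}s_cons s_cons /= mem_last. Qed.

Lemma klist_head_gt0 : 0 < head 0 s.
Proof. by case/and3P: sk => _ _ /allP; apply; exact: klist_mem_head. Qed.

Lemma klist_head_lt_last : head 0 s < last 0 s.
Proof.
case: s s_size k_ge2 s_sorted => [|a [|b s']] /= <- // _ /andP[ab].
rewrite -(last_cons a) => /(order_path_min ltn_trans) bs.
apply: leq_trans ab _ => /=; have := mem_last b s'; rewrite inE.
by case/predU1P => [->//|/(allP bs)/ltnW].
Qed.

Lemma inside_lt_head t : t < head 0 s -> inside s t = false.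
Proof.
move=> th; rewrite /inside cnt_eq0 //.
by apply/allP => j /klist_head_le; exact: leq_trans.
Qed.

Lemma inside_head : inside s (head 0 s).
Proof.
rewrite /inside cntS // klist_mem_head cnt_eq0 //.
by apply/allP => j /klist_head_le.
Qed.

Lemma inside_ge_last t : last 0 s <= t -> inside s t = false.
Proof.
move=> lt; rewrite /inside cnt_size ?s_size ?(negbTE k_even) //.
by apply/allP => j /klist_le_last; rewrite ltnS => /leq_trans; apply.
Qed.

Lemma inside_last : inside s (last 0 s).-1.
Proof.
have := inside_ge_last (leqnn _); rewrite /inside cntS // klist_mem_last addn1 /=.
by rewrite prednK ?(leq_trans klist_head_gt0 (ltnW klist_head_lt_last)) // => /negbFE.
Qed.

Lemma mem_inside j : (j.+1 \in s) = (inside s j.+1 != inside s j).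
Proof. by rewrite /inside [cnt s j.+2]cntS // oddD; case: (odd _); case: (_ \in _). Qed.

End Klist.

(** The elements are the places where the parity jumps; [0] is never among them. *)
Lemma inside_inj k s s' : klist k s -> klist k s' -> inside s =1 inside s' -> s = s'.
Proof.
move=> sk sk' ss'; have [so _ sp] := and3P sk; have [so' _ sp'] := and3P sk'.
apply: (irr_sorted_eq ltn_trans ltnn) => // -[|j].
  by rewrite (contraNF (allP sp 0)) // (contraNF (allP sp' 0)).
by rewrite (mem_inside sk) (mem_inside sk') !ss'.
Qed.

Definition word (s s' : seq nat) n : seq letter :=
  mkseq (fun t => (inside s t, inside s' t)) n.

(** The letter at time [t] differs from the previous one only if [t] lies in [s] or [s']. *)
Lemma changes_word s s' n : changes (word s s' n) <= cnt s n + cnt s' n.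
Proof.
have lastE m : last (false, false) (word s s' m) = (odd (cnt s m), odd (cnt s' m)).
  by case: m => [|m]; [rewrite !cnt_eq0 //; exact/allP | rewrite /word mkseqS last_rcons].
have cnt_mono r m : cnt r m <= cnt r m.+1 by apply: sub_count => j /ltnW.
elim: n => [//|n IHn]; rewrite /word mkseqS changes_rcons lastE.
have := cnt_mono s n; have := cnt_mono s' n.
case: eqVneq => [_|]; first by rewrite /word in IHn; lia.
move=> ne; suff : (cnt s n != cnt s n.+1) || (cnt s' n != cnt s' n.+1).
  by rewrite /word in IHn; lia.
apply: contraNT ne; rewrite negb_or !negbK => /andP[/eqP e /eqP e'].
by rewrite /inside e e'.
Qed.

Lemma mkseq_split (T : Type) (g : nat -> T) t n : t < n ->
  mkseq g n = mkseq g t ++ g t :: mkseq (fun i => g (t.+1 + i)) (n - t.+1).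
Proof.
move=> tn; rewrite -cat_rcons -mkseqS -[in LHS](subnKC tn) /mkseq iotaD map_cat.
by rewrite -[0 + _]addnC iotaDl -map_comp.
Qed.

(** * The generic equations for a pair of index lists *)

Section Words.
Variables (k : nat) (p : (nat -> Prop) -> Prop) (f : nat -> nat).
Hypotheses (k_ge2 : 2 <= k) (k_even : ~~ odd k) (p_idem : idempotent_nat p).
Variables (s s' : seq nat).
Hypotheses (sk : klist k s) (sk' : klist k s').

Local Notation n := (maxn (last 0 s) (last 0 s')).
Local Notation same := (fun u v => f u = f v).
Local Notation diff := (fun u v => f u <> f v).
Local Notation W := (word s s' n).

Let hl : head 0 s < last 0 s. Proof. exact: klist_head_lt_last sk. Qed.
Let hl' : head 0 s' < last 0 s'. Proof. exact: klist_head_lt_last sk'. Qed.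

Lemma word_split m t : t < m -> word s s' m = word s s' t ++
  (inside s t, inside s' t) ::
  mkseq (fun i => (inside s (t.+1 + i), inside s' (t.+1 + i))) (m - t.+1).
Proof. exact: mkseq_split. Qed.

Lemma has_fst_word m : head 0 s < m -> has fst (word s s' m).
Proof. by move/word_split->; rewrite has_cat /= (inside_head k_ge2 sk) orbT. Qed.

Lemma has_snd_word m : head 0 s' < m -> has snd (word s s' m).
Proof. by move/word_split->; rewrite has_cat /= (inside_head k_ge2 sk') orbT. Qed.

Lemma word_none t : t <= head 0 s -> t <= head 0 s' ->
  all (pred1 (false, false)) (word s s' t).
Proof.
move=> ts ts'; apply/allP => c /mapP[i]; rewrite mem_iota => /andP[_ it] ->.
by rewrite (inside_lt_head k_ge2 sk) ?(inside_lt_head k_ge2 sk') //= (leq_trans it).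
Qed.

Lemma word_max : W = rcons (word s s' n.-1) (inside s n.-1, inside s' n.-1).
Proof.
have n_gt0 : 0 < n by lia.
by rewrite /word -[in LHS](prednK n_gt0) mkseqS.
Qed.

Lemma word_max_same : last 0 s = last 0 s' -> W = rcons (word s s' n.-1) (true, true).
Proof.
move=> e; have nE : n = last 0 s by lia.
have nE' : n = last 0 s' by lia.
rewrite word_max; congr (rcons _ (_, _)).
  by rewrite nE (inside_last k_ge2 k_even sk).
by rewrite nE' (inside_last k_ge2 k_even sk').
Qed.

Lemma word_max_diff : last 0 s' < last 0 s ->
  W = rcons (word s s' n.-1) (true, false).
Proof.
move=> lt; have nE : n = last 0 s by lia.
rewrite word_max; congr (rcons _ (_, _)).
  by rewrite nE (inside_last k_ge2 k_even sk).
by rewrite (inside_ge_last k_even sk') //; lia.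
Qed.

Lemma gen_word_const : p (fun a => p (fun b => f a = f b)) -> gen p W same 0 0.
Proof.
move=> E1; apply: gen_const => //; first by apply: has_fst_word; lia.
by apply: has_snd_word; lia.
Qed.

Lemma gen_word_min_same : p (fun a => p (fun b => f (a + b) = f a)) ->
  head 0 s = head 0 s' -> gen p W same 0 0.
Proof.
move=> D e; rewrite (@word_split _ (head 0 s)); last by lia.
rewrite gen_skipsl ?word_none ?e // -{1}e.
by rewrite (inside_head k_ge2 sk) (inside_head k_ge2 sk'); exact: gen_min_same.
Qed.

Lemma gen_word_min_diff : p (fun a => p (fun b => f (a + b) = f a)) ->
  p (fun a => p (fun b => f a <> f b)) ->
  head 0 s < head 0 s' -> gen p W diff 0 0.
Proof.
move=> D nE lt; have hs : has snd W by apply: has_snd_word; lia.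
have sE := @word_split n (head 0 s); rewrite sE in hs *; try by lia.
move: hs; rewrite gen_skipsl ?word_none ?has_cat //=; last by lia.
rewrite (inside_head k_ge2 sk) (inside_lt_head k_ge2 sk') //= => /orP[|hs].
  have : all (pred1 (false, false)) (word s s' (head 0 s)) by apply: word_none; lia.
  by move=> /allP al /hasP[c /al/eqP ->].
exact: gen_min_diff.
Qed.

Lemma gen_word_max_same : p (fun a => p (fun b => f (a + b) = f b)) ->
  last 0 s = last 0 s' -> gen p W same 0 0.
Proof. by move=> D /word_max_same ->; exact: gen_max_same. Qed.

Lemma gen_word_max_diff : p (fun a => p (fun b => f (a + b) = f b)) ->
  p (fun a => p (fun b => f a <> f b)) ->
  last 0 s' < last 0 s -> gen p W diff 0 0.
Proof.
move=> D nE lt; rewrite word_max_diff //; apply: gen_max_diff => //.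
by apply: has_snd_word; lia.
Qed.

Lemma gen_word_max_diff_nomin : p (fun a => p (fun b => f (a + b) <> f a)) ->
  last 0 s' < last 0 s -> gen p W diff 0 0.
Proof. by move=> D /word_max_diff ->; exact: gen_max_diff_nomin. Qed.

Lemma gen_word_minmax_same :
  p (fun a => p (fun b => p (fun d => f (a + b + d) = f (a + d)))) ->
  head 0 s = head 0 s' -> last 0 s = last 0 s' -> gen p W same 0 0.
Proof.
move=> D eh el; rewrite word_max_same //.
(* Otherwise the minimum is [n.-1], the word has a single nonsilent letter and the two sums are
   equal. *)
have [hn|hn] := ltnP (head 0 s) n.-1; last first.
  rewrite -cats1 gen_skipsl ?word_none //; try by lia.
  by apply: (most_true p_idem).
rewrite (@word_split _ (head 0 s)) // rcons_cat /=.
rewrite gen_skipsl ?word_none ?eh // -{1}eh.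
by rewrite (inside_head k_ge2 sk) (inside_head k_ge2 sk'); exact: gen_minmax_same.
Qed.

Lemma gen_word_minmax_diff :
  p (fun a => p (fun b => p (fun d => f (a + b + d) = f (a + d)))) ->
  p (fun a => p (fun b => f (a + b) <> f b)) ->
  head 0 s < head 0 s' -> last 0 s = last 0 s' -> gen p W diff 0 0.
Proof.
move=> D nD lt el; rewrite word_max_same //.
rewrite (@word_split _ (head 0 s)) ?rcons_cat /=; last by lia.
rewrite gen_skipsl ?word_none //; last by lia.
rewrite (inside_head k_ge2 sk) (inside_lt_head k_ge2 sk') //.
exact: gen_minmax_diff.
Qed.

Lemma gen_word_rainbow t : p (fun a => p (fun b => f (a + b) <> f a)) ->
  p (fun a => p (fun b => p (fun d => f (a + b + d) <> f (a + d)))) ->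
  inside s t -> ~~ inside s' t -> (forall i, t < i -> inside s i = inside s' i) ->
  gen p W diff 0 0.
Proof.
move=> nD nP st s't eq_gt.
have tn : t < n.
  by rewrite ltnNge; apply: contraL st => nt; rewrite (inside_ge_last k_even sk) //; lia.
rewrite (word_split tn) st (negbTE s't); apply: gen_rainbow => //.
by apply/allP => c /mapP[i _ ->] /=; rewrite eq_gt //; lia.
Qed.

End Words.

(** * Every coloring admits one of the five patterns *)

Theorem canonical_pattern k (Delta : nat -> nat) : 2 <= k -> ~~ odd k ->
  exists2 x : nat -> nat, infinite_set_enum x & exists q, has_pattern k Delta x q.
Proof.
move=> k_ge2 k_even; have [p p_idem] := idempotent_nat_exists.
(* Each of the two index lists causes at most [k] changes. *)
have [y y_gt0 yP] := fusion p_idem (k + k) (fun u v => Delta u = Delta v).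
pose x := partial_sum y.
have xP : infinite_set_enum x.
  split=> [|i j _]; first by rewrite /x /partial_sum big_ord1.
  elim: j => // j IHj; have xS : x j.+1 = x j + y j by exact: big_ord_recr.
  have yj := y_gt0 j; rewrite ltnS leq_eqVlt xS => /predU1P[->|/IHj]; lia.
exists x => //.
pose same u v := Delta u = Delta v.
have key s s' : klist k s -> klist k s' ->
    (Delta (alt x s) = Delta (alt x s') <->
     gen p (word s s' (maxn (last 0 s) (last 0 s'))) same 0 0).
  move=> sk sk'; set n := maxn _ _.
  have [so /eqP sz _] := and3P sk; have [so' /eqP sz' _] := and3P sk'.
  have sn : all (fun j => j <= n) s.
    by apply/allP => j /(klist_le_last sk); rewrite leq_max => ->.
  have sn' : all (fun j => j <= n) s'.
    by apply/allP => j /(klist_le_last sk'); rewrite leq_max => ->; rewrite orbT.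
  rewrite !(@alt_msum y _ n) ?sz ?sz' //.
  have -> : mkseq (inside s) n = unzip1 (word s s' n) by rewrite /unzip1 -map_comp.
  have -> : mkseq (inside s') n = unzip2 (word s s' n) by rewrite /unzip2 -map_comp.
  rewrite -{2 4}(size_mkseq (fun t => (inside s t, inside s' t)) n); apply: yP.
  apply: leq_trans (changes_word _ _ _) _; rewrite -{1}sz -sz'.
  by rewrite leq_add // count_size.
have keyN s s' : klist k s -> klist k s' ->
    gen p (word s s' (maxn (last 0 s) (last 0 s'))) (fun u v => Delta u <> Delta v) 0 0 ->
    Delta (alt x s) <> Delta (alt x s').
  by move=> sk sk' g /(key _ _ sk sk') g'; case: (gen_clash p_idem g').
(* The four equations are tested in turn: (iv) and (iii) use the failure of the first, (v) that of
   the second and third, (ii) that of the second and fourth. *)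
have [E1|nE1] := most_em2 p_idem (fun a b => Delta a = Delta b).
  exists P_i => m n [I /klist_listing Ik ->] [J /klist_listing Jk ->].
  by rewrite !altsumE; apply/key => //; exact: (gen_word_const k_ge2).
have [Dmin|nDmin] := most_em2 p_idem (fun a b => Delta (a + b) = Delta a).
  have ne s s' : klist k s -> klist k s' -> head 0 s < head 0 s' ->
      Delta (alt x s) <> Delta (alt x s').
    by move=> sk sk' lt; apply: keyN => //; apply: (gen_word_min_diff k_ge2) lt.
  exists P_iv => I J /klist_listing Ik /klist_listing Jk.
  rewrite !altsumE /minJ; split=> [e|e]; last first.
    by apply/key => //; exact: (gen_word_min_same k_ge2).
  have [lt|lt|//] := ltngtP (head 0 (listing I)) (head 0 (listing J)).
    by case: (ne _ _ Ik Jk lt).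
  by case: (ne _ _ Jk Ik lt).
have [Dmax|nDmax] := most_em2 p_idem (fun a b => Delta (a + b) = Delta b).
  have ne s s' : klist k s -> klist k s' -> last 0 s' < last 0 s ->
      Delta (alt x s) <> Delta (alt x s').
    by move=> sk sk' lt; apply: keyN => //; apply: (gen_word_max_diff k_ge2) lt.
  exists P_iii => I J /klist_listing Ik /klist_listing Jk.
  rewrite !altsumE /maxJ; split=> [e|e]; last first.
    by apply/key => //; exact: (gen_word_max_same k_ge2).
  have [lt|lt|//] := ltngtP (last 0 (listing I)) (last 0 (listing J)).
    by case: (ne _ _ Jk Ik lt).
  by case: (ne _ _ Ik Jk lt).
have nemax s s' : klist k s -> klist k s' -> last 0 s' < last 0 s ->
    Delta (alt x s) <> Delta (alt x s').
  by move=> sk sk' lt; apply: keyN => //; apply: (gen_word_max_diff_nomin k_ge2) lt.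
have [Dmid|nDmid] := most_em3 p_idem (fun a b d => Delta (a + b + d) = Delta (a + d)).
  have nemin s s' : klist k s -> klist k s' -> last 0 s = last 0 s' ->
      head 0 s < head 0 s' -> Delta (alt x s) <> Delta (alt x s').
    by move=> sk sk' e lt; apply: keyN => //; apply: (gen_word_minmax_diff k_ge2) lt e.
  exists P_v => I J /klist_listing Ik /klist_listing Jk.
  rewrite !altsumE /minJ /maxJ; split=> [e|[eh el]]; last first.
    by apply/key => //; exact: (gen_word_minmax_same k_ge2).
  have el : last 0 (listing I) = last 0 (listing J).
    have [lt|lt|//] := ltngtP (last 0 (listing I)) (last 0 (listing J)).
      by case: (nemax _ _ Jk Ik lt).
    by case: (nemax _ _ Ik Jk lt).
  split=> //; have [lt|lt|//] := ltngtP (head 0 (listing I)) (head 0 (listing J)).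
    by case: (nemin _ _ Ik Jk el lt).
  by case: (nemin _ _ Jk Ik (esym el) lt).
exists P_ii => m n [I /klist_listing Ik ->] [J /klist_listing Jk ->].
rewrite !altsumE; move: (listing I) (listing J) Ik Jk => s s' sk sk' ne.
have exd : exists t, inside s t != inside s' t.
  apply: contrapT => nex; apply: ne; congr (alt x _); apply: (inside_inj sk sk') => t.
  by apply/eqP/negPn/negP => nt; apply: nex; exists t.
have bnd i : inside s i != inside s' i -> i <= maxn (last 0 s) (last 0 s').
  apply: contraNleq; rewrite gtn_max => /andP[/ltnW si /ltnW s'i].
  by rewrite (inside_ge_last k_even sk) // (inside_ge_last k_even sk').
(* At the last time [i] of disagreement exactly one list is inside a block; it takes the first role
   in [gen_word_rainbow]. *)
case: (ex_maxnP exd bnd) => i ii imax.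
have eq_gt j : i < j -> inside s j = inside s' j.
  by move=> ij; apply/eqP; apply: contraTT ij => /imax; rewrite -leqNgt.
have [si|nsi] := boolP (inside s i).
  apply: keyN => //; apply: (gen_word_rainbow k_ge2 k_even p_idem sk sk' nDmin nDmid si) => //.
  by move: ii; rewrite si; case: inside.
apply: nesym; apply: keyN => //.
apply: (gen_word_rainbow k_ge2 k_even p_idem sk' sk nDmin nDmid (t := i)) => //.
  by move: ii nsi; case: inside; case: inside.
by move=> j /eq_gt.
Qed.

(** * Sharpness *)

(** The odd parts of [u] and [u + d] differ by an even number. *)
Lemma logn2_same_dvd u d : 0 < u -> 0 < d -> logn 2 u = logn 2 (u + d) ->
  2 ^ (logn 2 u).+1 %| d.
Proof.
move=> u_gt0 d_gt0; have ud_gt0 : 0 < u + d by lia.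
have [a oa uE] := pfactor_coprime (isT : prime 2) u_gt0.
have [b ob udE] := pfactor_coprime (isT : prime 2) ud_gt0.
move=> e; rewrite -e in udE; rewrite coprime2n in oa; rewrite coprime2n in ob.
have dE : d = (b - a) * 2 ^ logn 2 u by rewrite mulnBl -uE -udE addKn.
have p_gt0 : 0 < 2 ^ logn 2 u by rewrite expn_gt0.
have ab : a <= b by rewrite -(leq_pmul2r p_gt0) -uE -udE leq_addr.
by rewrite expnS [X in _ %| X]dE dvdn_pmul2r // dvdn2 oddB // oa ob.
Qed.

Lemma logn2_add u d : 0 < u -> 0 < d -> logn 2 u != logn 2 (u + d) ->
  minn (logn 2 u) (logn 2 (u + d)) = logn 2 d.
Proof.
move=> u_gt0 d_gt0 ne; have ud_gt0 : 0 < u + d by lia.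
have dvd m e : 0 < m -> (2 ^ e %| m) = (e <= logn 2 m) by exact: pfactor_dvdn.
apply/eqP; rewrite eqn_leq; apply/andP; split.
  set m := minn _ _.
  have mu : 2 ^ m %| u by rewrite dvd // geq_minl.
  have mud : 2 ^ m %| u + d by rewrite dvd // geq_minr.
  by rewrite -dvd // -(dvdn_addr _ mu).
rewrite leqNgt; apply/negP; rewrite -dvd // => dm.
have := dvdn_addl u dm; rewrite !dvd //; lia.
Qed.

Lemma logn2_lt u d : 0 < u -> 0 < d -> logn 2 d < logn 2 (u + d) ->
  logn 2 u = logn 2 d.
Proof.
move=> u_gt0 d_gt0 lt; have [e|ne] := eqVneq (logn 2 u) (logn 2 (u + d)).
  have := logn2_same_dvd u_gt0 d_gt0 e; rewrite pfactor_dvdn //; lia.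
by have := logn2_add u_gt0 d_gt0 ne; lia.
Qed.

(* Both pairs at distance [d] contain an element of valuation exactly [logn 2 d]
   unless the pair itself collides. *)
Lemma logn2_cube u g d : 0 < u -> 0 < g -> g < d ->
  ~ {in [:: u; u + g; u + d; u + g + d] &, injective (logn 2)}.
Proof.
move=> u0 g0 gd inj; have d0 : 0 < d by lia.
have ne v : v \in [:: u; u + g] -> v + d \in [:: u; u + g; u + d; u + g + d] ->
    minn (logn 2 v) (logn 2 (v + d)) = logn 2 d.
  move=> vi vdi; apply: logn2_add => //; first by move: vi; rewrite !inE; lia.
  apply/eqP => /inj; rewrite !inE in vi vdi *; lia.
have e1 := ne u; have e2 := ne (u + g); rewrite !inE !eqxx !orbT in e1 e2.
have {e1}e1 := e1 isT isT; have {e2}e2 := e2 isT isT.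
have := inj u (u + g); have := inj u (u + g + d).
have := inj (u + d) (u + g); have := inj (u + d) (u + g + d).
rewrite !inE !eqxx !orbT /=; lia.
Qed.

Lemma bounded_collision (h : nat -> nat) B : (forall i, h i < B) ->
  exists i j, i < j /\ h i = h j.
Proof.
move=> hB; pose g (i : 'I_B.+1) := Ordinal (hB i).
have /injectivePn[i [j ij gij]] : ~~ injectiveb g.
  apply/injectiveP => /leq_card; rewrite !card_ord ltnn.
  by [].
have hij : h i = h j by exact: (congr1 val gij).
have [lt|lt|/val_inj] := ltngtP i j; first by exists i, j.
  by exists j, i.
by move/eqP; rewrite (negbTE ij).
Qed.

Lemma alt_cat x s t : ~~ odd (size s) -> alt x (s ++ t) = alt x s + alt x t.
Proof.
move=> os; elim/seq_pair_ind: s / os => [|a b s IHs]; last first.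
  by rewrite /= !alt_cons2 IHs addnA.
by rewrite {2}/alt big_ord0.
Qed.

Lemma alt_dvd x s m q : ~~ odd (size s) ->
  {in s, forall j, x j = q %[mod m]} -> m %| alt x s.
Proof.
move=> os; elim/seq_pair_ind: s / os => [|a b s IHs] sq.
  by rewrite /alt big_ord0.
rewrite alt_cons2 dvdn_add ?IHs //; last first.
  by move=> j js; apply: sq; rewrite !inE js !orbT.
have [ab|/ltnW] := leqP (x a) (x b); last by rewrite -subn_eq0 => /eqP ->.
by rewrite -eqn_mod_dvd // !sq // !inE eqxx ?orbT.
Qed.

Definition list_pattern k (Delta x : nat -> nat) q : Prop :=
  forall s t, klist k s -> klist k t ->
  let same := Delta (alt x s) = Delta (alt x t) in
  match q with
  | P_i => same
  | P_ii => same -> alt x s = alt x t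
  | P_iii => same <-> last 0 s = last 0 t
  | P_iv => same <-> head 0 s = head 0 t
  | P_v => same <-> head 0 s = head 0 t /\ last 0 s = last 0 t
  end.

Lemma has_pattern_list k Delta x q : has_pattern k Delta x q -> list_pattern k Delta x q.
Proof.
move=> hq s t sk tk.
have [ss _ _] := and3P sk; have [ts _ _] := and3P tk.
have [Is It] := (ksubset_seq sk, ksubset_seq tk).
have := (altsumE x [fset j in s]%fset, altsumE x [fset j in t]%fset).
rewrite !listing_seq // => -[es et].
case: q hq => /= h.
- by rewrite -es -et; apply: h; [exists [fset j in s]%fset | exists [fset j in t]%fset].
- move=> e; apply/eqP; apply: contra_eqT e => /eqP ne; apply/eqP.
  by rewrite -es -et in ne *; apply: h ne; [exists [fset j in s]%fset | exists [fset j in t]%fset].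
- by have := h _ _ Is It; rewrite /maxJ !listing_seq // es et.
- by have := h _ _ Is It; rewrite /minJ !listing_seq // es et.
- by have := h _ _ Is It; rewrite /minJ /maxJ !listing_seq // es et.
Qed.

Section Enumeration.
Variable x : nat -> nat.
Hypothesis xP : infinite_set_enum x.

Lemma enum_lt i j : 0 < i -> i < j -> x i < x j.
Proof. by case: xP => _; apply. Qed.

Lemma enum_le i j : 0 < i -> i <= j -> x i <= x j.
Proof. by move=> i0; rewrite leq_eqVlt => /predU1P[->//|/(enum_lt i0)/ltnW]. Qed.

Lemma enum_gap i j : 0 < i -> i <= j -> x i + (j - i) <= x j.
Proof.
move=> i0; elim: j => [|j IHj]; first by lia.
rewrite leq_eqVlt ltnS => /predU1P[->|ij]; first by rewrite subnn addn0.
have := IHj ij; have := @enum_lt j j.+1; lia.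
Qed.

Lemma enum_ge j : 0 < j -> j <= x j.
Proof. by move=> j0; have := @enum_gap 1 j isT j0; have := xP.1; lia. Qed.

End Enumeration.

Section Sharpness.
Variables (k : nat) (x : nat -> nat).
Hypotheses (k_ge2 : 2 <= k) (k_even : ~~ odd k) (xP : infinite_set_enum x).

Lemma alt_gt0 s : klist k s -> 0 < alt x s.
Proof.
case/and3P=> ss /eqP sk sp; have : 1 < size s by rewrite sk.
case: s ss sp {sk} => [|a [|b s]] //= /andP[ab _] /andP[a0 _] _.
rewrite alt_cons2; have := enum_lt xP a0 ab; lia.
Qed.

(** Elements of [t] carry opposite signs in the two alternating sums; the additive form avoids
    truncated subtraction. *)
Lemma alt_ends a t M : ~~ odd (size t) -> 0 < a -> path ltn a (rcons t M) ->
  alt x (a :: rcons t M) + alt x t + x a = x M.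
Proof.
move=> ot; elim/seq_pair_ind: t / ot a => [a a0|b c t IHt a a0] /=.
  rewrite andbT => /(enum_lt xP a0) aM; rewrite alt_cons2 /alt !big_ord0; lia.
case/and3P=> ab bc ct; rewrite !alt_cons2.
have b0 : 0 < b by lia.
have := IHt c (ltn_trans b0 bc) ct.
have := enum_lt xP a0 ab; have := enum_lt xP b0 bc; lia.
Qed.

Lemma path_iota a n m b t : a < n -> n + m <= b -> path ltn b t ->
  path ltn a (iota n m ++ b :: t).
Proof.
move=> an nb bt; elim: m a n an nb => [|m IHm] a n an nb /=.
  by rewrite bt andbT; lia.
by rewrite an IHm //; lia.
Qed.

(** With the interior fixed, the alternating sum is [x M - x a] up to a constant. Below, [n = 4]
    leaves the minima [1], [2], [3], and [k.+2] is then the least maximum. *)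
Definition ends n a M := a :: rcons (iota n (k - 2)) M.
(** Moving [b] or [q] changes the alternating sum but neither the minimum nor the maximum. *)
Definition quad a b q M := iota 1 (k - 4) ++ [:: a; b; q; M].

Lemma last_ends n a M : last 0 (ends n a M) = M.
Proof. by rewrite /ends /= last_rcons. Qed.

Lemma ends_path n a M : a < n -> n + (k - 2) <= M ->
  path ltn a (rcons (iota n (k - 2)) M).
Proof. by move=> an nM; rewrite -cats1 path_iota. Qed.

Lemma klist_ends n a M : 0 < a -> a < n -> n + (k - 2) <= M -> klist k (ends n a M).
Proof.
move=> a0 an nM; apply/and3P; split; first exact: ends_path.
  by rewrite /= size_rcons size_iota; lia.
rewrite /ends /= all_rcons a0 /=; apply/andP; split; first by lia.
by apply/allP => j; rewrite mem_iota /=; lia.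
Qed.

Lemma alt_ends_eq n a M : 0 < a -> a < n -> n + (k - 2) <= M ->
  alt x (ends n a M) + alt x (iota n (k - 2)) + x a = x M.
Proof.
move=> a0 an nM; apply: alt_ends => //; last exact: ends_path.
by rewrite size_iota oddB // addbF.
Qed.

Lemma klist_quad a b q M : 4 <= k -> k - 4 < a -> a < b -> b < q -> q < M ->
  klist k (quad a b q M).
Proof.
move=> k_ge4 ka ab bq qM; apply/and3P; split; rewrite /quad.
- have bqM : path ltn a [:: b; q; M] by rewrite /= ab bq qM.
  case: (k - 4) ka => [|m] ma; first exact: bqM.
  by apply: path_iota bqM.
- by rewrite size_cat size_iota /=; lia.
- rewrite all_cat /=; apply/andP; split; last by lia.
  by apply/allP => j; rewrite mem_iota; lia.
Qed.

Lemma alt_quad_eq a b q M : 4 <= k -> 0 < a -> a < b -> b < q -> q < M ->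
  alt x (quad a b q M) + x a + x q = alt x (iota 1 (k - 4)) + x b + x M.
Proof.
move=> k_ge4 a0 ab bq qM; rewrite alt_cat ?size_iota ?oddB ?(negbTE k_even) //.
have alt0 : alt x [::] = 0 by rewrite /alt big_ord0.
rewrite !alt_cons2 alt0.
by have := enum_lt xP a0 ab; have := @enum_lt x xP q M; lia.
Qed.

Lemma no_pattern_const q : q <> P_i -> ~ has_pattern k (fun=> 1) x q.
Proof.
move=> ne /has_pattern_list h.
have k1 : klist k (ends 4 1 k.+2) by apply: klist_ends; lia.
have k2 : klist k (ends 4 2 k.+2) by apply: klist_ends; lia.
have k3 : klist k (ends 4 1 k.+3) by apply: klist_ends; lia.
case: q ne h => // _ h.
- have /= := h _ _ k1 k2 erefl.
  have := @alt_ends_eq 4 1 k.+2; have := @alt_ends_eq 4 2 k.+2.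
  by have := @enum_lt x xP 1 2; lia.
- by have [/(_ erefl)] := h _ _ k1 k3; rewrite !last_ends; lia.
- by have [/(_ erefl)] := h _ _ k1 k2.
- by have [/(_ erefl)[]] := h _ _ k1 k2.
Qed.

Lemma no_pattern_id q : q <> P_ii -> (q = P_v -> 4 <= k) -> ~ has_pattern k id x q.
Proof.
move=> ne k_ge4 /has_pattern_list h.
have k1 : klist k (ends 4 1 k.+2) by apply: klist_ends; lia.
have k2 : klist k (ends 4 2 k.+2) by apply: klist_ends; lia.
have k3 : klist k (ends 4 1 k.+3) by apply: klist_ends; lia.
have ne12 : alt x (ends 4 1 k.+2) <> alt x (ends 4 2 k.+2).
  have := @alt_ends_eq 4 1 k.+2; have := @alt_ends_eq 4 2 k.+2.
  by have := @enum_lt x xP 1 2; lia.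
have ne13 : alt x (ends 4 1 k.+2) <> alt x (ends 4 1 k.+3).
  have := @alt_ends_eq 4 1 k.+2; have := @alt_ends_eq 4 1 k.+3.
  by have := @enum_lt x xP k.+2 k.+3; lia.
case: q ne k_ge4 h => // _ k_ge4 h.
- by apply: ne12; exact: h.
- by apply: ne12; apply/(h _ _ k1 k2); rewrite !last_ends.
- by apply: ne13; apply/(h _ _ k1 k3).
- have {}k_ge4 := k_ge4 erefl.
  have k4 : klist k (quad (k - 3) (k - 2) k k.+1) by apply: klist_quad; lia.
  have k5 : klist k (quad (k - 3) (k - 1) k k.+1) by apply: klist_quad; lia.
  have : alt x (quad (k - 3) (k - 2) k k.+1) = alt x (quad (k - 3) (k - 1) k k.+1).
    by apply/(h _ _ k4 k5); rewrite /quad !last_cat; split=> //; case: (k - 4).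
  have := @alt_quad_eq (k - 3) (k - 2) k k.+1.
  have := @alt_quad_eq (k - 3) (k - 1) k k.+1.
  by have := @enum_lt x xP (k - 2) (k - 1); lia.
Qed.

(** The factor comes from [x j >= j] at the index [j = M + (x M).*2]. *)
Lemma ends_double M : k.+2 <= M ->
  (alt x (ends 4 1 M)).*2 <= alt x (ends 4 1 (M + (x M).*2)).
Proof.
move=> kM; have := @alt_ends_eq 4 1 M; have := @alt_ends_eq 4 1 (M + (x M).*2).
by have := @enum_ge x xP (M + (x M).*2); lia.
Qed.

Lemma ends_log_diff :
  exists M, k.+2 <= M /\ trunc_log 2 (alt x (ends 4 1 k.+2)) <> trunc_log 2 (alt x (ends 4 1 M)).
Proof.
exists (k.+2 + (x k.+2).*2); split; first by lia.
have a0 : 0 < alt x (ends 4 1 k.+2) by apply: alt_gt0; apply: klist_ends; lia.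
have := leq_trunc_log 2 (ends_double (leqnn _)).
by rewrite trunc_log2_double //; lia.
Qed.

Lemma no_pattern_log q : q <> P_iii -> ~ has_pattern k (fun n => (trunc_log 2 n).+1) x q.
Proof.
move=> ne /has_pattern_list h.
have k1 : klist k (ends 4 1 k.+2) by apply: klist_ends; lia.
have [M [kM neM]] := ends_log_diff.
have kM1 : klist k (ends 4 1 M) by apply: klist_ends; lia.
(* For maximum [N] the other terms take away at most half of [x N], so the logarithm has at most two
   values on the three minima, and two minima collide. *)
pose N := k.+2 + (x k.+2).*2.
have xN : (x k.+2).*2 <= x N by have := @enum_ge x xP N; rewrite /N; lia.
have c_lt : alt x (iota 4 (k - 2)) + x 3 <= x k.+2.
  by have := @alt_ends_eq 4 3 k.+2; lia.
have vP a : 0 < a -> a < 4 -> [/\ klist k (ends 4 a N),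
    trunc_log 2 (alt x (ends 4 a N)) <= trunc_log 2 (x N) &
    trunc_log 2 (x N) <= (trunc_log 2 (alt x (ends 4 a N))).+1].
  move=> a0 a4; have ka : klist k (ends 4 a N) by apply: klist_ends; rewrite /N; lia.
  have := @alt_ends_eq 4 a N a0 a4; have := @enum_le x xP a 3 a0; rewrite /N -/N => xa eN.
  split=> //; first by apply: leq_trunc_log; lia.
  by rewrite -trunc_log2_double ?alt_gt0 //; apply: leq_trunc_log; lia.
have [a [b [a0 ab b4 e]]] : exists a b, [/\ 0 < a, a < b, b < 4 &
    trunc_log 2 (alt x (ends 4 a N)) = trunc_log 2 (alt x (ends 4 b N))].
  have [_ ? ?] := vP 1 isT isT; have [_ ? ?] := vP 2 isT isT; have [_ ? ?] := vP 3 isT isT.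
  have [e|ne12] := eqVneq (trunc_log 2 (alt x (ends 4 1 N))) (trunc_log 2 (alt x (ends 4 2 N))).
    by exists 1, 2.
  have [e|ne13] := eqVneq (trunc_log 2 (alt x (ends 4 1 N))) (trunc_log 2 (alt x (ends 4 3 N))).
    by exists 1, 3.
  by exists 2, 3; split=> //; lia.
have [[ka _ _] [kb _ _]] := (vP a a0 (ltn_trans ab b4), vP b (ltn_trans a0 ab) b4).
case: q ne h => // _ h.
- by case: neM; have /= := h _ _ k1 kM1; case.
- have /= := h _ _ ka kb; rewrite e => /(_ erefl).
  have := @alt_ends_eq 4 a N; have := @alt_ends_eq 4 b N.
  by have := @enum_lt x xP a b; rewrite /N; lia.
- by have /= [/(_ _)] := h _ _ ka kb; rewrite e => /(_ erefl); lia.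
- by have /= [+ _] := h _ _ ka kb; rewrite e => /(_ erefl)[]; lia.
Qed.

Lemma klist_iota n : 0 < n -> klist k (iota n k).
Proof.
move=> n0; rewrite /klist iota_ltn_sorted size_iota eqxx /=.
by apply/allP => j; rewrite mem_iota; lia.
Qed.

(** Lowering the minimum from [2] to [1] adds [d = x 2 - x 1]. Capping valuations just above that of
    [d], the pigeonhole principle gives two maxima that agree for minimum [1], or whose valuations
    there both exceed that of [d]; in the second case minimum [2] yields the valuation of [d]
    twice. *)
Lemma val_collision : exists s t, [/\ klist k s, klist k t, alt x s <> alt x t,
  last 0 s <> last 0 t & logn 2 (alt x s) = logn 2 (alt x t)].
Proof.
have x12 := @enum_lt x xP 1 2 isT isT.
pose v a i := alt x (ends 4 a (k.+2 + i)).
have kv a i : 0 < a -> a < 3 -> klist k (ends 4 a (k.+2 + i)).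
  by move=> a0 a3; apply: klist_ends; lia.
have vE i : v 1 i = v 2 i + (x 2 - x 1).
  by have := @alt_ends_eq 4 1 (k.+2 + i); have := @alt_ends_eq 4 2 (k.+2 + i); rewrite /v; lia.
have v_inj a i j : 0 < a -> a < 3 -> i < j -> v a i <> v a j.
  move=> a0 a3 ij; have := @alt_ends_eq 4 a (k.+2 + i); have := @alt_ends_eq 4 a (k.+2 + j).
  by have := @enum_lt x xP (k.+2 + i) (k.+2 + j); rewrite /v; lia.
have [|i [j [ij e]]] := @bounded_collision
    (fun i => minn (logn 2 (v 1 i)) (logn 2 (x 2 - x 1)).+1) (logn 2 (x 2 - x 1)).+2.
  by move=> i; lia.
suff [a [a0 a3 ea]] : exists a, [/\ 0 < a, a < 3 & logn 2 (v a i) = logn 2 (v a j)].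
  exists (ends 4 a (k.+2 + i)), (ends 4 a (k.+2 + j)).
  by split; rewrite ?last_ends; [exact: kv | exact: kv | exact: v_inj | lia | exact: ea].
have [ee|ne] := eqVneq (logn 2 (v 1 i)) (logn 2 (v 1 j)); first by exists 1.
exists 2; split=> //; have d0 : 0 < x 2 - x 1 by lia.
have v0 l : 0 < v 2 l by apply: alt_gt0; exact: kv.
by rewrite !(logn2_lt (v0 _) d0) // -vE; lia.
Qed.

(** A constant valuation [e] would make [x] constant modulo [2 ^ e.+1] from [k.+2] on, so that
    [2 ^ e.+1] would divide later alternating sums. *)
Lemma val_diff : exists s t, [/\ klist k s, klist k t &
  logn 2 (alt x s) <> logn 2 (alt x t)].
Proof.
apply: contrapT => nex.
have eq_val s t : klist k s -> klist k t -> logn 2 (alt x s) = logn 2 (alt x t).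
  by move=> sk tk; apply: contrapT => ne; apply: nex; exists s, t.
have k1 M : k.+2 <= M -> klist k (ends 4 1 M) by move=> kM; apply: klist_ends; lia.
have kI : klist k (iota k.+2 k) by apply: klist_iota.
set e := logn 2 (alt x (iota k.+2 k)).
have xmod M : k.+2 <= M -> x M = x k.+2 %[mod 2 ^ e.+1].
  rewrite leq_eqVlt => /predU1P[<-//|kM].
  have lt := @enum_lt x xP k.+2 M isT kM.
  apply/eqP; rewrite eqn_mod_dvd ?(ltnW lt) // /e (eq_val _ (ends 4 1 k.+2)) ?k1 //.
  have E : alt x (ends 4 1 M) = alt x (ends 4 1 k.+2) + (x M - x k.+2).
    by have := @alt_ends_eq 4 1 M; have := @alt_ends_eq 4 1 k.+2; lia.
  apply: logn2_same_dvd; rewrite ?alt_gt0 ?k1 ?subn_gt0 // -E.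
  by apply: eq_val; apply: k1; lia.
have : 2 ^ e.+1 %| alt x (iota k.+2 k).
  apply: alt_dvd; first by rewrite size_iota.
  move=> j; rewrite mem_iota => /andP[kj _]; exact: xmod.
by rewrite pfactor_dvdn ?alt_gt0 // ltnn.
Qed.

Lemma no_pattern_val q : q <> P_iv -> ~ has_pattern k (fun n => (logn 2 n).+1) x q.
Proof.
move=> ne /has_pattern_list h.
have [s [t [sk tk nalt nlast e]]] := val_collision.
case: q ne h => // _ h.
- by have [s' [t' [sk' tk' []]]] := val_diff; have /= := h _ _ sk' tk'; case.
- by apply: nalt; apply: h; rewrite ?e.
- by apply: nlast; apply/(h _ _ sk tk); rewrite e.
- by case: nlast; have [[]] := (h _ _ sk tk).1 (congr1 succn e).
Qed.

(** Varying the minimum under the maximum [M + k] would make [x] constant modulo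
    [2 ^ (e (M + k)).+1] on the indices up to [M.+1]. Hence [e (M + k) < e M], an infinite
    descent. *)
Lemma val_not_max : ~ (forall s t, klist k s -> klist k t ->
  last 0 s = last 0 t -> logn 2 (alt x s) = logn 2 (alt x t)).
Proof.
move=> h; pose e M := logn 2 (alt x (iota (M - k).+1 k)).
have last_iota M : k <= M -> last 0 (iota (M - k).+1 k) = M.
  by move=> kM; rewrite (last_nth 0) size_iota -[k in nth _ _ k](prednK (ltnW k_ge2)) /= nth_iota; lia.
have descent M : k <= M -> e (M + k) < e M.
  move=> kM; have kE a : 0 < a -> a < M.+2 -> klist k (ends M.+2 a (M + k)).
    by move=> a0 aM; apply: klist_ends; lia.
  have eE a : 0 < a -> a < M.+2 -> logn 2 (alt x (ends M.+2 a (M + k))) = e (M + k).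
    move=> a0 aM; apply: h; rewrite ?kE ?klist_iota // last_ends last_iota //; lia.
  have xmod a : 0 < a -> a < M.+2 -> x a = x 1 %[mod 2 ^ (e (M + k)).+1].
    rewrite leq_eqVlt => /predU1P[<-//|a1 aM]; have lt := @enum_lt x xP 1 a isT a1.
    apply/eqP; rewrite eqn_mod_dvd ?(ltnW lt) // -(eE a) ?(ltnW a1) //.
    have E : alt x (ends M.+2 1 (M + k)) = alt x (ends M.+2 a (M + k)) + (x a - x 1).
      by have := @alt_ends_eq M.+2 1 (M + k); have := @alt_ends_eq M.+2 a (M + k); lia.
    by apply: logn2_same_dvd; rewrite ?alt_gt0 ?kE ?subn_gt0 ?(ltnW a1) // -E !eE ?(ltnW a1).
  rewrite /e -pfactor_dvdn ?alt_gt0 ?klist_iota //.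
  apply: alt_dvd; first by rewrite size_iota.
  by move=> j; rewrite mem_iota => jM; apply: xmod; lia.
have bound i : e (k + i * k) + i <= e k.
  elim: i => [|i IHi]; first by rewrite mul0n !addn0.
  by have := descent (k + i * k); rewrite -addnA -mulSnr; lia.
by have := bound (e k).+1; lia.
Qed.

(** For fixed [q], two choices of [a] and of [b] give four sums, two of which have equal valuation
    by [logn2_cube]. Without a collision, a power of two must then separate the least sum from the
    greatest. This cannot happen for two values of [q] whose ranges are disjoint but lie within a
    factor of two. *)
Lemma pair_collision : 4 <= k -> exists s t, [/\ klist k s, klist k t,
  alt x s <> alt x t, logn 2 (alt x s) = logn 2 (alt x t) &
  trunc_log 2 (alt x s) = trunc_log 2 (alt x t)].
Proof.
move=> k_ge4; apply: contrapT => nex.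
have inj s t : klist k s -> klist k t -> logn 2 (alt x s) = logn 2 (alt x t) ->
    trunc_log 2 (alt x s) = trunc_log 2 (alt x t) -> alt x s = alt x t.
  by move=> sk tk e1 e2; apply: contrapT => ne; apply: nex; exists s, t.
pose c := alt x (iota 1 (k - 4)).
pose a1 := k - 3; pose a2 := k - 2; pose b1 := k - 1.
(* This [b2] ensures [g < d] for [logn2_cube]; [q2] makes the two ranges disjoint, and [M] makes the
   sums large compared with their spread. *)
pose b2 := b1 + (x a2 - x a1).+1.
pose q1 := b2.+1; pose q2 := q1 + x b2 + x a2.
pose M := q2 + (x q2).*2 + c + x b2.
have [xa xab xb] : [/\ x a1 < x a2, x a2 < x b1 & x b1 + (x a2 - x a1).+1 <= x b2].
  have := @enum_gap x xP b1 b2; rewrite /b2 /b1 /a2 /a1.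
  by split; [apply: (enum_lt xP); lia | apply: (enum_lt xP); lia | lia].
have xq1 : x b2 < x q1 by apply: (enum_lt xP); rewrite /q1 /b2 /b1; lia.
have xq2 : x q1 + x b2 + x a2 <= x q2.
  by have := @enum_gap x xP q1 q2; rewrite /q2 /q1; lia.
have xM : x q2 < x M by apply: (enum_lt xP); rewrite /M /q2 /q1; lia.
have MxM : q2 + (x q2).*2 + c + x b2 <= x M by apply: (enum_ge xP); rewrite /q2 /q1; lia.
have [a12 ab b12] : [/\ k - 4 < a1 < a2, a2 < b1 & b1 < b2] by rewrite /b2 /b1 /a2 /a1; split; lia.
have [bq q12 qM] : [/\ b2 < q1, q1 <= q2 & q2 < M].
  by rewrite /M /q2 /q1; have : 0 < x b2 by [lia]; split; lia.
pose u q := alt x (quad a2 b1 q M); pose g := x a2 - x a1; pose d := x b2 - x b1.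
have clear q : q1 <= q <= q2 -> trunc_log 2 (u q) <> trunc_log 2 (u q + g + d).
  move=> q12' eq_log.
  have kq a b : a \in [:: a1; a2] -> b \in [:: b1; b2] -> klist k (quad a b q M).
    by rewrite !inE => ai bi; apply: klist_quad => //; lia.
  have qE a b : a \in [:: a1; a2] -> b \in [:: b1; b2] ->
      alt x (quad a b q M) + x a + x q = c + x b + x M.
    by rewrite !inE => ai bi; apply: alt_quad_eq => //; lia.
  have u0 : 0 < u q by apply: alt_gt0; apply: kq; rewrite !inE eqxx ?orbT.
  have := qE a1 b1; have := qE a1 b2; have := qE a2 b1; have := qE a2 b2.
  rewrite !inE !eqxx !orbT -/(u q) => /(_ isT isT) q22 /(_ isT isT) q21 /(_ isT isT) q112 /(_ isT isT) q11.
  apply: (@logn2_cube (u q) g d) => //; rewrite ?/g ?/d; try by lia.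
  have quadP v : v \in [:: u q; u q + g; u q + d; u q + g + d] ->
      exists2 s, klist k s & v = alt x s.
    rewrite !inE => /or4P[] /eqP ->.
    - by exists (quad a2 b1 q M) => //; apply: kq; rewrite !inE eqxx ?orbT.
    - exists (quad a1 b1 q M); first by apply: kq; rewrite !inE eqxx ?orbT.
      by rewrite /g; lia.
    - exists (quad a2 b2 q M); first by apply: kq; rewrite !inE eqxx ?orbT.
      by rewrite /d; lia.
    - exists (quad a1 b2 q M); first by apply: kq; rewrite !inE eqxx ?orbT.
      by rewrite /g /d; lia.
  have log_const v : v \in [:: u q; u q + g; u q + d; u q + g + d] ->
      trunc_log 2 v = trunc_log 2 (u q).
    move=> vi; apply/eqP; rewrite eqn_leq {1}eq_log.
    by rewrite !leq_trunc_log //; move: vi; rewrite !inE; lia.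
  move=> v w vi wi; have [s sk vs] := quadP v vi; have [t tk wt] := quadP w wi.
  move=> e; rewrite vs wt; apply: inj; rewrite -?vs -?wt //.
  by rewrite (log_const v) ?(log_const w).
have uE q : q1 <= q <= q2 -> u q + x a2 + x q = c + x b1 + x M.
  by move=> qi; apply: alt_quad_eq => //; lia.
have q1i : q1 <= q1 <= q2 by lia.
have q2i : q1 <= q2 <= q2 by lia.
have [c1 c2] := (clear q1 q1i, clear q2 q2i).
have [u1 u2] := (uE q1 q1i, uE q2 q2i).
(* These inequalities chain to two jumps of the logarithm between [u q2] and its double. *)
have l2 := @leq_trunc_log 2 (u q2) (u q2 + g + d).
have l21 := @leq_trunc_log 2 (u q2 + g + d) (u q1).
have l1 := @leq_trunc_log 2 (u q1) (u q1 + g + d).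
have l12 := @leq_trunc_log 2 (u q1 + g + d) (u q2).*2.
have u20 : 0 < u q2 by lia.
rewrite trunc_log2_double // in l12; rewrite /g /d in l2 l21 l1 l12 c1 c2; lia.
Qed.

Lemma no_pattern_pair q : 4 <= k -> q <> P_v ->
  ~ has_pattern k (fun n => (choice.pickle (logn 2 n, trunc_log 2 n)).+1) x q.
Proof.
move=> k_ge4 ne /has_pattern_list h.
have pairE m n : (choice.pickle (logn 2 m, trunc_log 2 m)).+1 =
    (choice.pickle (logn 2 n, trunc_log 2 n)).+1 ->
    logn 2 m = logn 2 n /\ trunc_log 2 m = trunc_log 2 n.
  by move=> [/(pcan_inj choice.pickleK)[]].
have k1 : klist k (ends 4 1 k.+2) by apply: klist_ends; lia.
have [M [kM neM]] := ends_log_diff.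
have kM1 : klist k (ends 4 1 M) by apply: klist_ends; lia.
case: q ne h => // _ h.
- by apply: neM; have /pairE[] := h _ _ k1 kM1.
- have [s [t [sk tk nalt e1 e2]]] := pair_collision k_ge4.
  by apply: nalt; apply: h; rewrite ?e1 ?e2.
- by apply: val_not_max => s t sk tk /(h _ _ sk tk)/pairE[].
- by apply: neM; have /pairE[] := (h _ _ k1 kM1).2 erefl.
Qed.

End Sharpness.

(** * The case k = 2 *)

Lemma listing_inj I J : listing I = listing J -> I = J.
Proof. by move=> e; apply/fsetP => j; rewrite -!mem_listing e. Qed.

Lemma ksubset2 J : ksubset 2 J -> exists a b,
  [/\ 0 < a, a < b, listing J = [:: a; b] & forall x, altsum x J = x b - x a].
Proof.
move=> /klist_listing/and3P[]; case E : (listing J) => [|a [|b [|]]] //=.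
rewrite andbT => ab _ /and3P[a0 b0 _]; exists a, b; split=> // x.
by rewrite altsumE E alt_cons2 /alt big_ord0 addn0.
Qed.

Lemma minmax_inj2 I J : ksubset 2 I -> ksubset 2 J ->
  minJ I = minJ J -> maxJ I = maxJ J -> I = J.
Proof.
move=> /ksubset2[a [b [_ _ eI _]]] /ksubset2[c [d [_ _ eJ _]]].
by rewrite /minJ /maxJ eI eJ /= => ac bd; apply: listing_inj; rewrite eI eJ ac bd.
Qed.

Lemma minmax_rainbow2 Delta x : has_pattern 2 Delta x P_v -> has_pattern 2 Delta x P_ii.
Proof.
move=> hv m n [I Ik ->] [J Jk ->] ne /(hv _ _ Ik Jk)[eh el].
by apply: ne; rewrite (minmax_inj2 Ik Jk eh el).
Qed.

Lemma rainbow_minmax2 Delta x : distinct_altsums 2 x ->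
  has_pattern 2 Delta x P_ii -> has_pattern 2 Delta x P_v.
Proof.
move=> dist hii I J Ik Jk; split=> [e|[eh el]].
  suff -> : I = J by [].
  apply: dist => //; apply/eqP; apply: contra_eqT e => /eqP ne; apply/eqP.
  by apply: hii ne; [exists I | exists J].
by rewrite (minmax_inj2 Ik Jk eh el).
Qed.

(** * Thinning out an infinite set *)

Section Sparse.
Variable x : nat -> nat.
Hypothesis xP : infinite_set_enum x.

(** As [x j >= j], the value of [x] at the next index exceeds twice the current value. *)
Fixpoint sparse_index n := if n is m.+1 then (x (sparse_index m)).*2.+1 else 1.
Local Notation y := (fun n => x (sparse_index n)).

Lemma sparse_index_gt0 n : 0 < sparse_index n.
Proof. by case: n. Qed.

Lemma sparse_double n : (y n).*2 < y n.+1.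
Proof. exact: (enum_ge xP). Qed.

Lemma sparse_index_lt i j : i < j -> sparse_index i < sparse_index j.
Proof.
elim: j => // j IHj; rewrite ltnS leq_eqVlt.
have ge := enum_ge xP (sparse_index_gt0 j).
by case/predU1P => [->|/IHj] /=; lia.
Qed.

Lemma sparse_lt i j : i < j -> y i < y j.
Proof. by move=> /sparse_index_lt; exact/(enum_lt xP)/sparse_index_gt0. Qed.

Lemma sparse_double_lt i j : i < j -> (y i).*2 < y j.
Proof.
case: j => // j; rewrite ltnS leq_eqVlt => /predU1P[->|/sparse_lt].
  exact: sparse_double.
by have := sparse_double j; lia.
Qed.

Lemma sparse_enum : infinite_set_enum y.
Proof.
split=> [|i j _]; last exact: sparse_lt.
by have := sparse_double 0; lia.
Qed.

(** A difference [y b - y a] is more than half of [y b] and at most [y b], so it determines [b] and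
    then [a]. *)
Lemma sparse_distinct : distinct_altsums 2 y.
Proof.
move=> I J /ksubset2[a [b [_ ab eI ->]]] /ksubset2[c [d [_ cd eJ ->]]] e.
apply: listing_inj; rewrite eI eJ.
have [yab ycd] := (sparse_lt ab, sparse_lt cd).
have [dbl1 dbl2] := (sparse_double_lt ab, sparse_double_lt cd).
have bd : b = d.
  have [lt|lt|//] := ltngtP b d.
    by have := sparse_double_lt lt; lia.
  by have := sparse_double_lt lt; lia.
subst d; congr [:: _; _].
by have [/sparse_lt|/sparse_lt|//] := ltngtP a c; lia.
Qed.

Lemma sparse_Xalt n : Xalt 2 y n -> Xalt 2 x n.
Proof.
move=> [J /ksubset2[a [b [a0 ab _ ->]]] ->].
have iab := sparse_index_lt ab.
have kl : klist 2 [:: sparse_index a; sparse_index b].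
  by rewrite /klist /= iab !sparse_index_gt0.
exists [fset j in [:: sparse_index a; sparse_index b]]%fset; first exact: ksubset_seq.
rewrite altsumE listing_seq; last by case/and3P: kl.
by rewrite alt_cons2 /alt big_ord0 addn0.
Qed.

End Sparse.

Definition pattern_witness (p : pattern) (n : nat) : nat :=
  match p with
  | P_i => 1
  | P_ii => n
  | P_iii => (trunc_log 2 n).+1
  | P_iv => (logn 2 n).+1
  | P_v => (choice.pickle (logn 2 n, trunc_log 2 n)).+1
  end.

Lemma pattern_witness_coloring p : coloring (pattern_witness p).
Proof. by move=> n n_gt0; case: p. Qed.

(** The proviso on (v) reflects that for [k = 2] the identity coloring has pattern (v) on sparse
    sets. *)
Lemma pattern_witness_sharp k x p q : 2 <= k -> ~~ odd k -> infinite_set_enum x ->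
  (p = P_v \/ q = P_v -> 4 <= k) -> q <> p -> ~ has_pattern k (pattern_witness p) x q.
Proof.
move=> k_ge2 k_even xP k_ge4; case: p k_ge4 => k_ge4 ne.
- exact: no_pattern_const.
- by apply: no_pattern_id => // e; apply: k_ge4; right.
- exact: no_pattern_log.
- exact: no_pattern_val.
- by apply: no_pattern_pair => //; apply: k_ge4; left.
Qed.

Theorem theorem7p1 (k : nat) (k_ge2 : 2 <= k) (k_even : ~~ odd k) :
  [/\ (forall Delta : nat -> nat, coloring Delta ->
         exists2 x : nat -> nat, infinite_set_enum x &
           exists p : pattern, has_pattern k Delta x p),
      (4 <= k -> forall p : pattern,
         exists2 Delta : nat -> nat, coloring Delta &
           forall x : nat -> nat, infinite_set_enum x ->
             forall q : pattern, q <> p -> ~ has_pattern k Delta x q),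
      (k = 2 -> forall Delta : nat -> nat, coloring Delta ->
         forall x : nat -> nat, infinite_set_enum x ->
         [/\ (has_pattern k Delta x P_v -> has_pattern k Delta x P_ii),
             (distinct_altsums k x ->
                (has_pattern k Delta x P_ii <-> has_pattern k Delta x P_v))
           & (has_pattern k Delta x P_ii ->
                exists y : nat -> nat,
                  [/\ infinite_set_enum y, enum_subset y x
                    & has_pattern k Delta y P_v])])
    & (k = 2 -> forall p : pattern, p <> P_v ->
         exists2 Delta : nat -> nat, coloring Delta &
           forall x : nat -> nat, infinite_set_enum x ->
             forall q : pattern, q <> p -> q <> P_v ->
               ~ has_pattern k Delta x q)].
Proof.
split.
- by move=> Delta _; exact: canonical_pattern.
- move=> k_ge4 p; exists (pattern_witness p); first exact: pattern_witness_coloring.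
  by move=> x xP q ne; exact: pattern_witness_sharp.
- move=> k2 Delta _ x xP; subst k; split.
  + exact: minmax_rainbow2.
  + by move=> dist; split; [exact: rainbow_minmax2 | exact: minmax_rainbow2].
  (* Pattern (ii) passes to subsets, and on a sparse one it amounts to (v). *)
  + move=> hii; exists (fun n => x (sparse_index x n)); split.
    * exact: sparse_enum.
    * by move=> i _; exists (sparse_index x i) => //; exact: sparse_index_gt0.
    * apply: rainbow_minmax2; first exact: sparse_distinct.
      by move=> m n /(sparse_Xalt xP) Am /(sparse_Xalt xP) An; exact: hii.
- move=> k2 p pv; exists (pattern_witness p); first exact: pattern_witness_coloring.
  move=> x xP q ne qv; apply: pattern_witness_sharp => //.
  by case.
Qed.
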